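(* Fix $h\in\mathbb R$ with $\kappa(h)=\frac h3\left(\frac h3-1\right)>0$ and $M\ge0$. There exist a small constant $R>0$ and a constant $B>0$, depending only on $h$ and $M$, such that for every $f\in\mathcal C(M)$ the following holds, with $\beta(f)=f''(1)$. For every $\mu\in\mathbb R$ with $|\mu|/(\kappa(h)+\beta(f))\le R$ there is a solution $\phi^\mu\in C^2([0,1])$ of the equation $$\phi''(r)+\frac2r\left(\phi'(r)-\frac{\phi(r)}r\right)=V_1(u(r))\,\frac1r\left(\phi'(r)-\frac{\phi(r)}r\right)+\frac{\mu}{\kappa(h)+\beta(f)}\,r\,v(r)^{-h/3+1}\,V_2(u(r)),\quad r\in[0,1],\qquad ( * )$$ satisfying $$\phi^\mu(0)=D_r^2\phi^\mu(0)=0,\qquad D_r\phi^\mu(0)=1,$$ and, for $r\in[0,1]$, the estimates $$|\phi^\mu(r)/r-1|\le Rr^2,\quad |D_r\phi^\mu(r)-1|\le Rr^2,\quad |u^\mu(r)-1|\le Rr^2,\quad |D_r^2\phi^\mu(r)|\le Rr,$$ and such that: (1) the map $\mu\mapsto\phi^\mu$ from $\{\mu:|\mu|/(\kappa(h)+\beta(f))\le R\}$ to $C([0,1])$ is continuous; (2) if $\mu>0$, then $\lambda_1^\mu(r)=D_r\phi^\mu(r)>\lambda_2^\mu(r)=\phi^\mu(r)/r>1$ for $r\in(0,1]$; if $\mu<0$, then $\lambda_1^\mu(r)<\lambda_2^\mu(r)<1$ for $r\in(0,1]$; (3) if $\beta(f)\ge B$, then there exists an eigenvalue $\mu\neq0$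 (with $|\mu|/(\kappa(h)+\beta(f))\le R$) with $\operatorname{sgn}\mu=-\operatorname{sgn}h$ such that $\phi^\mu$ satisfies the boundary condition $g(u^\mu(1))=0$, where $g(u)=\frac h3f(u)+uf'(u)$.
   Context: The class $\mathcal C(M)$: all $f\in C^3$ on $\{|u-1|\le1/8\}$ with $f(1)=1$, $f'(1)=0$, $f''(1)>0$ and $\sup_{|u-1|\le 1/8}|f'''(u)|\le Mf''(1)$. Let $\delta=\min\{1/8,\,1/(8|h|),\,1/(8M)\}$ (with $1/(8M)=+\infty$ if $M=0$). For $|u-1|\le\delta$ define $$U_1(u)=\kappa(h)f(u)+\tfrac{2h}3uf'(u)+u^2f''(u),$$ $$U_2(u)=2\kappa(h)uf(u)+\left(\tfrac h3-1\right)u^2f'(u)+(2u^2+u^3)\frac{f'(u)}{u-1}-u^3f''(u)$$ (with $f'(u)/(u-1)$ read as $f''(1)$ at $u=1$), and $$V_1(u)=\frac{2U_1(u)-U_2(u)}{U_1(u)},\qquad V_2(u)=\frac{(\kappa(h)+\beta(f))\,u}{U_1(u)};$$ $U_1>0$ there, so $V_1,V_2$ are well-defined. For a function $\phi$ on $[0,1]$ set $\lambda_1(r)=\phi'(r)$, $\lambda_2(r)=\phi(r)/r$, $v(r)=\lambda_1(r)\lambda_2(r)^2$, $u(r)=\lambda_1(r)/\lambda_2(r)$; a superscript $\mu$ means these are formed from $\phi^\mu$. A solution of $( * )$ is understood to satisfy $\phi(0)=\phi''(0)=0$, $\phi'>0$ on $[0,1]$, and $|u(r)-1|\le\delta$ on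 $[0,1]$ (so that all coefficients are defined). Expressions at $r=0$ involving division by $r$ are understood as limits as $r\to0$ (so $\lambda_2(0)=\phi'(0)$, $u(0)=1$). *)

(* Defs.v *)
From Stdlib Require Import Reals.
From Coquelicot Require Import Coquelicot.
Open Scope R_scope.

(* Derivatives on a closed interval are taken relative to the interval
   (one-sided at the endpoints), as in [D_in].  On a nondegenerate interval
   they are determined by the function, so the derivatives are passed as
   explicit companions f', f'', ... of f. *)
Definition deriv_on (D : R -> Prop) (f f' : R -> R) : Prop :=
  forall x, D x -> D_in f f' D x.

Definition cont_on (D : R -> Prop) (f : R -> R) : Prop :=
  forall x, D x -> continue_in f D x.

Definition C2_on (D : R -> Prop) (f f' f'' : R -> R) : Prop :=
  deriv_on D f f' /\ deriv_on D f' f'' /\ cont_on D f''.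

Definition C3_on (D : R -> Prop) (f f' f'' f''' : R -> R) : Prop :=
  deriv_on D f f' /\ deriv_on D f' f'' /\ deriv_on D f'' f''' /\
  cont_on D f'''.

Definition near1 (u : R) : Prop := Rabs (u - 1) <= 1 / 8.

Definition unit_itv (r : R) : Prop := 0 <= r <= 1.

Definition class_C (M : R) (f f' f'' f''' : R -> R) : Prop :=
  C3_on near1 f f' f'' f''' /\
  f 1 = 1 /\ f' 1 = 0 /\ f'' 1 > 0 /\
  (forall u, near1 u -> Rabs (f''' u) <= M * f'' 1).

Definition kappa (h : R) : R := h / 3 * (h / 3 - 1).

Definition beta (f'' : R -> R) : R := f'' 1.

(* The term 1/(8M) is +oo, hence drops out of the minimum, when M = 0. *)
Definition delta (h M : R) : R :=
  let d := Rmin (1 / 8) (1 / (8 * Rabs h)) in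
  if Req_EM_T M 0 then d else Rmin d (1 / (8 * M)).

(* f'(u)/(u-1), with its limit f''(1) at u = 1. *)
Definition dquot (f' f'' : R -> R) (u : R) : R :=
  if Req_EM_T u 1 then f'' 1 else f' u / (u - 1).

Definition U1 (h : R) (f f' f'' : R -> R) (u : R) : R :=
  kappa h * f u + 2 * h / 3 * u * f' u + u ^ 2 * f'' u.

Definition U2 (h : R) (f f' f'' : R -> R) (u : R) : R :=
  2 * kappa h * u * f u + (h / 3 - 1) * u ^ 2 * f' u
  + (2 * u ^ 2 + u ^ 3) * dquot f' f'' u - u ^ 3 * f'' u.

Definition V1 (h : R) (f f' f'' : R -> R) (u : R) : R :=
  (2 * U1 h f f' f'' u - U2 h f f' f'' u) / U1 h f f' f'' u.

Definition V2 (h : R) (f f' f'' : R -> R) (u : R) : R :=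
  (kappa h + beta f'') * u / U1 h f f' f'' u.

Definition lambda1 (phi' : R -> R) (r : R) : R := phi' r.

(* phi(r)/r, with its limit phi'(0) at r = 0 (phi vanishes at 0). *)
Definition lambda2 (phi phi' : R -> R) (r : R) : R :=
  if Req_EM_T r 0 then phi' 0 else phi r / r.

Definition vfun (phi phi' : R -> R) (r : R) : R :=
  lambda1 phi' r * lambda2 phi phi' r ^ 2.

Definition ufun (phi phi' : R -> R) (r : R) : R :=
  lambda1 phi' r / lambda2 phi phi' r.

(* q is the value at r of (1/r)(phi'(r) - phi(r)/r), where the value at r = 0
   is the limit as r -> 0+. *)
Definition is_quot (phi phi' : R -> R) (r q : R) : Prop :=
  (r <> 0 /\ q = 1 / r * (phi' r - phi r / r)) \/
  (r = 0 /\
   filterlim (fun s => 1 / s * (phi' s - phi s / s)) (at_right 0) (locally q)).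

(* The equation at the point r; the right-hand side contains
   v^(-h/3+1) with v > 0. *)
Definition ode_at (h mu : R) (f f' f'' phi phi' phi'' : R -> R) (r : R)
  : Prop :=
  exists q, is_quot phi phi' r q /\
    phi'' r + 2 * q =
    V1 h f f' f'' (ufun phi phi' r) * q
    + mu / (kappa h + beta f'') * r
      * Rpower (vfun phi phi' r) (- h / 3 + 1)
      * V2 h f f' f'' (ufun phi phi' r).

Definition solution (h M mu : R) (f f' f'' phi phi' phi'' : R -> R) : Prop :=
  C2_on unit_itv phi phi' phi'' /\
  phi 0 = 0 /\ phi'' 0 = 0 /\
  (forall r, unit_itv r -> phi' r > 0) /\
  (forall r, unit_itv r -> Rabs (ufun phi phi' r - 1) <= delta h M) /\
  (forall r, unit_itv r -> ode_at h mu f f' f'' phi phi' phi'' r).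

Definition admissible (h Rc : R) (f'' : R -> R) (mu : R) : Prop :=
  Rabs mu / (kappa h + beta f'') <= Rc.

(* Restriction to [0,1]; [fct_UniformSpace] on this type carries the uniformity
   of the sup norm, i.e. that of C([0,1]). *)
Definition restr01 (phi : R -> R) : fct_UniformSpace {r : R | unit_itv r} R_UniformSpace :=
  fun r => phi (proj1_sig r).

Definition gfun (h : R) (f f' : R -> R) (u : R) : R := h / 3 * f u + u * f' u.

(* Main.v *)
Require Import Defs.
From Stdlib Require Import Reals Lra Lia.
From Coquelicot Require Import Coquelicot.
Open Scope R_scope.

(** Put [q = (phi(r)/r)'], [m = mu / (kappa + beta)] and [q = r p].  Since
    [phi'/r - phi/r^2 = q] and [phi'' = 2 q + r q'], the equation reads
    [r q' + 4 q = V1(u) q + m r v^(1-h/3) V2(u)], that is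
    [(r^5 p)' = r^4 G] with [G = V1(u) p + m v^(1-h/3) V2(u)].  With the
    transverse stretch [L = phi/r = 1 + int_0^r s p(s) ds] one has
    [u = (L + r^2 p)/L] and [v = (L + r^2 p) L^2], so the problem, singular
    at the centre, becomes the regular fixed point equation
    [p(r) = int_0^1 t^4 G(r t) dt] for a continuous function [p].

    At the undeformed state [u = v = 1] the coefficients are [V1 = 0] and
    [V2 = 1], so [G] is [m] up to an error of order [m^2], and [p] is close
    to [m/5].  On the set of continuous [p] with [|p - m/5| <= |m|/20] the map
    is a contraction once [|m| <= Rc] is small ([profile_map_stable],
    [profile_map_diff]).  The same estimate with two parameters makes [p]
    Lipschitz in [m] ([profile_lipschitz]), whence the continuity of
    [mu |-> phi].  The sign of [p] is that of [m], which orders [lambda1],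
    [lambda2] and [1].

    The radius [Rc] must not depend on [f].  The energy class bounds [f'],
    [f''], [f'''] and [f'/(u-1)] by multiples of [beta], and [U1] is at least
    [(kappa + beta)/2]; after division by [kappa + beta] the numerator and the
    denominator of [V1] and [V2] are bounded and Lipschitz with constants that
    involve [h] and [M] only ([V_lipschitz], [exists_good_radius]).

    For the boundary condition, [u(1) - 1] has the sign of [m] and size at
    least [|m|/20].  Hence at [m = - Rc sgn h] the term [u f'(u)] of [g], of
    size [beta Rc], beats [h/3 f(u)] as soon as [beta] is large, and [g(u(1))]
    has the sign opposite to its value [h/3] at [m = 0].  The intermediate
    value theorem in [m] gives the eigenvalue ([boundary_eigenvalue]). *)

(** * Neighbourhoods and geometric bounds on the real line *)

Lemma Rabs_div_pos x y : 0 < y -> Rabs (x / y) = Rabs x / y.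
Proof. intros H. rewrite Rabs_div, (Rabs_pos_eq y) by lra. reflexivity. Qed.

Lemma continuous_eps (f : R -> R) (x : R) :
  continuous f x <->
  (forall eps, 0 < eps -> exists d, 0 < d /\
     forall y, Rabs (y - x) < d -> Rabs (f y - f x) < eps).
Proof.
  unfold continuous; rewrite filterlim_locally; split.
  - intros H eps He. destruct (H (mkposreal eps He)) as [d Hd].
    exists d; split; [apply cond_pos|]. intros y Hy. exact (Hd y Hy).
  - intros H eps. destruct (H eps (cond_pos eps)) as [d [Hd H']].
    exists (mkposreal d Hd). intros y Hy. exact (H' y Hy).
Qed.

Lemma continuous_of_ex_derive (f : R -> R) (x : R) : ex_derive f x -> continuous f x.
Proof. apply (ex_derive_continuous (V := R_NormedModule)). Qed.

Lemma locally_neq_0 (r : R) : r <> 0 -> locally r (fun y => y <> 0).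
Proof.
  intros Hr. assert (Hp : 0 < Rabs r) by (apply Rabs_pos_lt; exact Hr).
  exists (mkposreal _ Hp). intros y Hy ->.
  change (Rabs (0 - r) < Rabs r) in Hy.
  rewrite Rminus_0_l, Rabs_Ropp in Hy. lra.
Qed.

Lemma small_pow2 (K eps : R) : 0 <= K -> 0 < eps -> exists n : nat, K * (/ 2) ^ n < eps.
Proof.
  intros HK He.
  destruct (pow_lt_1_zero (/ 2)) with (y := eps / (K + 1)) as [n Hn].
  - rewrite Rabs_pos_eq; lra.
  - apply Rdiv_lt_0_compat; lra.
  - exists n. specialize (Hn n (Nat.le_refl n)).
    rewrite Rabs_pos_eq in Hn by (apply pow_le; lra).
    apply Rmult_lt_compat_l with (r := K + 1) in Hn; [|lra].
    replace ((K + 1) * (eps / (K + 1))) with eps in Hn by (field; lra).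
    assert (0 < (/ 2) ^ n) by (apply pow_lt; lra). nra.
Qed.

(** Iterating the implication moves any initial bound to the fixed point [2 e] of
    [K |-> K / 2 + e]; this avoids forming the supremum of [|D|]. *)
Lemma halving_bound {A : Type} (D : A -> R) (K0 e : R) :
  0 <= K0 -> 0 <= e ->
  (forall a, Rabs (D a) <= K0) ->
  (forall K, 0 <= K -> (forall a, Rabs (D a) <= K) -> forall a, Rabs (D a) <= K / 2 + e) ->
  forall a, Rabs (D a) <= 2 * e.
Proof.
  intros HK0 He H0 H a.
  assert (Hn : forall n a, Rabs (D a) <= K0 * (/ 2) ^ n + 2 * e).
  { induction n as [|n IH]; intros b.
    - specialize (H0 b); simpl; lra.
    - assert (0 < (/ 2) ^ n) by (apply pow_lt; lra).
      eapply Rle_trans; [apply (H (K0 * (/ 2) ^ n + 2 * e)); [nra | exact IH]|].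
      simpl; lra. }
  apply Rnot_lt_le; intros Hlt.
  destruct (small_pow2 K0 (Rabs (D a) - 2 * e)) as [n Hn']; [lra | lra |].
  specialize (Hn n a). lra.
Qed.

(** * Fixed points of contractions in the uniform distance *)

Definition unif_closed {A : Type} (X : (A -> R) -> Prop) : Prop :=
  forall p, (forall eps, 0 < eps -> exists q, X q /\ forall a, Rabs (q a - p a) <= eps) -> X p.

(** An arbitrary common bound [K] stands for the uniform distance, so that
    nothing has to be assumed about suprema. *)
Definition half_contraction {A : Type} (X : (A -> R) -> Prop) (T : (A -> R) -> A -> R) : Prop :=
  forall p q K, X p -> X q -> 0 <= K -> (forall a, Rabs (p a - q a) <= K) ->
    forall a, Rabs (T p a - T q a) <= K / 2.

(** The limit is given by a formula, and not only shown to exist, so that the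
    fixed points of a family of maps form a function of the parameter without
    any choice. *)
Definition picard_limit {A : Type} (T : (A -> R) -> A -> R) (p0 : A -> R) (a : A) : R :=
  real (Lim_seq (fun n => Nat.iter n T p0 a)).

(** Consecutive iterates are [K / 2^n] apart, hence uniformly Cauchy: every tail
    stays within [K / 2^n] of the [n]-th iterate because the tail is the image
    of an earlier tail under [T]. *)
Lemma picard_fixed_point {A : Type} (X : (A -> R) -> Prop) (T : (A -> R) -> A -> R)
    (p0 : A -> R) (K : R) :
  0 <= K -> unif_closed X -> half_contraction X T -> (forall p, X p -> X (T p)) ->
  X p0 -> (forall p q, X p -> X q -> forall a, Rabs (p a - q a) <= K) ->
  X (picard_limit T p0) /\ forall a, T (picard_limit T p0) a = picard_limit T p0 a.
Proof.
  intros HK0 Hcl Hct HT H0 HK.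
  set (p := picard_limit T p0).
  set (s := fun n => Nat.iter n T p0).
  assert (HX : forall n, X (s n)).
  { induction n; [exact H0 | apply HT; exact IHn]. }
  assert (Hc : forall n k a, Rabs (s (k + n)%nat a - s n a) <= K * (/ 2) ^ n).
  { induction n as [|n IH]; intros k a.
    - simpl. rewrite Rmult_1_r. apply HK; auto.
    - replace (k + S n)%nat with (S (k + n)) by lia.
      change (Rabs (T (s (k + n)%nat) a - T (s n) a) <= K * (/ 2) ^ S n).
      assert (0 < (/ 2) ^ n) by (apply pow_lt; lra).
      eapply Rle_trans; [apply (Hct _ _ (K * (/ 2) ^ n)); auto; nra|]. simpl; lra. }
  assert (Hlim : forall a, is_lim_seq (fun n => s n a) (p a)).
  { intros a. apply Lim_seq_correct'. apply ex_lim_seq_cauchy_corr.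
    intros eps. destruct (small_pow2 K (eps / 2)) as [N HN]; [lra | apply is_pos_div_2 |].
    exists N. intros n m Hn Hm.
    pose proof (Hc N (n - N)%nat a) as H1. pose proof (Hc N (m - N)%nat a) as H2.
    replace (n - N + N)%nat with n in H1 by lia.
    replace (m - N + N)%nat with m in H2 by lia.
    apply Rabs_le_between in H1. apply Rabs_le_between in H2.
    apply Rabs_def1; lra. }
  assert (Hu : forall n a, Rabs (s n a - p a) <= K * (/ 2) ^ n).
  { intros n a.
    assert (HL : is_lim_seq (fun k => Rabs (s n a - s (k + n)%nat a)) (Rabs (s n a - p a))).
    { apply is_lim_seq_abs with (l := Finite (s n a - p a)).
      apply is_lim_seq_minus'; [apply is_lim_seq_const|].
      apply is_lim_seq_incr_n with (u := fun k => s k a). apply Hlim. }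
    assert (HC : Rbar_le (Rabs (s n a - p a)) (K * (/ 2) ^ n)).
    { apply (is_lim_seq_le _ (fun _ => K * (/ 2) ^ n) _ _) with (2 := HL);
        [|apply is_lim_seq_const].
      intros k. cbv beta. rewrite Rabs_minus_sym. apply Hc. }
    exact HC. }
  assert (HXp : X p).
  { apply Hcl. intros eps He. destruct (small_pow2 K eps HK0 He) as [n Hn].
    exists (s n). split; [apply HX|]. intros a. specialize (Hu n a). lra. }
  split; [exact HXp|].
  intros a. apply Rminus_diag_uniq. apply Rabs_eq_0.
  apply Rle_antisym; [|apply Rabs_pos].
  apply Rnot_lt_le; intros Hlt.
  destruct (small_pow2 K (Rabs (T p a - p a)) HK0 Hlt) as [n Hn].
  assert (0 < (/ 2) ^ n) by (apply pow_lt; lra).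
  assert (H1 : Rabs (T (s n) a - T p a) <= K * (/ 2) ^ n / 2).
  { apply Hct; auto. nra. }
  pose proof (Hu (S n) a) as H2. change (s (S n) a) with (T (s n) a) in H2.
  simpl in H2.
  apply Rabs_le_between in H1. apply Rabs_le_between in H2.
  assert (Rabs (T p a - p a) <= K * (/ 2) ^ n) by (apply Rabs_le; lra). lra.
Qed.

(** * Means with weight [t^4] *)

(** The weight is the integrating factor of the radial equation: by scaling,
    [r^5 * mean4 g r] is the primitive of [s^4 g(s)], yet [mean4 g] itself needs
    no division at the centre. *)
Definition mean4 (g : R -> R) (r : R) : R := RInt (fun t => t ^ 4 * g (r * t)) 0 1.

Lemma continuous_mean4_integrand (g : R -> R) (r : R) :
  (forall s, continuous g s) -> forall t, continuous (fun t => t ^ 4 * g (r * t)) t.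
Proof.
  intros Hg t. apply (continuous_mult (fun t => t ^ 4) (fun t => g (r * t))).
  - apply continuous_of_ex_derive; auto_derive; auto.
  - apply continuous_comp; [|apply Hg].
    apply (continuous_of_ex_derive (fun t => r * t)); auto_derive; auto.
Qed.

Lemma ex_RInt_cont (g : R -> R) (a b : R) : (forall s, continuous g s) -> ex_RInt g a b.
Proof. intros Hg; apply (ex_RInt_continuous (V := R_CompleteNormedModule)); auto. Qed.

Lemma RInt_pow4 : RInt (fun t : R => t ^ 4) 0 1 = / 5.
Proof.
  apply is_RInt_unique.
  replace (/ 5) with (minus (1 ^ 5 / 5) (0 ^ 5 / 5))
    by (unfold minus, plus, opp; simpl; field).
  apply (is_RInt_derive (fun t => t ^ 5 / 5) (fun t => t ^ 4)).
  - intros x _. auto_derive; [auto|]. simpl; field.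
  - intros x _. apply (continuous_of_ex_derive (fun t => t ^ 4)); auto_derive; auto.
Qed.

(** The weight has total mass [1/5]: an error [e] around the constant [c] becomes
    an error [e/5] around [c/5]. *)
Lemma mean4_lin (g k : R -> R) (r c e : R) :
  (forall s, continuous g s) -> (forall s, continuous k s) ->
  (forall t, 0 <= t <= 1 -> Rabs (g (r * t) - k (r * t) - c) <= e) ->
  Rabs (mean4 g r - mean4 k r - c / 5) <= e / 5.
Proof.
  intros Hg Hk H. unfold mean4.
  assert (E : forall a : R, RInt (fun t => a * t ^ 4) 0 1 = a / 5).
  { intros a. transitivity (scal a (RInt (fun t : R => t ^ 4) 0 1)).
    - rewrite <- (RInt_scal (V := R_CompleteNormedModule)); [reflexivity|].
      apply ex_RInt_cont. intros s.
      apply (continuous_of_ex_derive (fun t => t ^ 4)); auto_derive; auto.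
    - rewrite RInt_pow4. reflexivity. }
  assert (Ce : forall a s, continuous (fun t => a * t ^ 4) s).
  { intros a s. apply (continuous_of_ex_derive (fun t => a * t ^ 4)); auto_derive; auto. }
  assert (X : RInt (fun t => t ^ 4 * g (r * t)) 0 1 - RInt (fun t => t ^ 4 * k (r * t)) 0 1
    = RInt (fun t => t ^ 4 * g (r * t) - t ^ 4 * k (r * t)) 0 1).
  { symmetry; apply (RInt_minus (V := R_CompleteNormedModule));
    apply ex_RInt_cont; apply continuous_mean4_integrand; auto. }
  rewrite X.
  assert (I : ex_RInt (fun t => t ^ 4 * g (r * t) - t ^ 4 * k (r * t)) 0 1).
  { apply (ex_RInt_minus (V := R_CompleteNormedModule));
    apply ex_RInt_cont; apply continuous_mean4_integrand; auto. }
  assert (L : RInt (fun t => (c - e) * t ^ 4) 0 1 <=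
              RInt (fun t => t ^ 4 * g (r * t) - t ^ 4 * k (r * t)) 0 1).
  { apply RInt_le; [lra | apply ex_RInt_cont; apply Ce | exact I |].
    intros t Ht. assert (Ht' : 0 <= t <= 1) by lra. specialize (H t Ht').
    apply Rabs_le_between in H. assert (0 <= t ^ 4) by (apply pow_le; lra). nra. }
  assert (U : RInt (fun t => t ^ 4 * g (r * t) - t ^ 4 * k (r * t)) 0 1 <=
              RInt (fun t => (c + e) * t ^ 4) 0 1).
  { apply RInt_le; [lra | exact I | apply ex_RInt_cont; apply Ce |].
    intros t Ht. assert (Ht' : 0 <= t <= 1) by lra. specialize (H t Ht').
    apply Rabs_le_between in H. assert (0 <= t ^ 4) by (apply pow_le; lra). nra. }
  rewrite E in L, U. apply Rabs_le; lra.
Qed.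

Lemma mean4_zero (r : R) : mean4 (fun _ => 0) r = 0.
Proof.
  unfold mean4. rewrite (RInt_ext _ (fun _ => 0)).
  - rewrite RInt_const. unfold scal; simpl; unfold mult; simpl; ring.
  - intros; apply Rmult_0_r.
Qed.

Lemma mean4_near (g : R -> R) (r c e : R) :
  (forall s, continuous g s) ->
  (forall t, 0 <= t <= 1 -> Rabs (g (r * t) - c) <= e) ->
  Rabs (mean4 g r - c / 5) <= e / 5.
Proof.
  intros Hg H.
  assert (H0 : Rabs (mean4 g r - mean4 (fun _ => 0) r - c / 5) <= e / 5).
  { apply mean4_lin; auto; [intros; apply continuous_const|].
    intros t Ht. rewrite Rminus_0_r. auto. }
  rewrite mean4_zero, Rminus_0_r in H0. exact H0.
Qed.

Lemma mean4_scale (g : R -> R) (r : R) :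
  (forall s, continuous g s) -> r ^ 5 * mean4 g r = RInt (fun s => s ^ 4 * g s) 0 r.
Proof.
  intros Hg.
  assert (C : forall s, continuous (fun s => s ^ 4 * g s) s).
  { intros s. apply (continuous_mult (fun s => s ^ 4) g); [|apply Hg].
    apply continuous_of_ex_derive; auto_derive; auto. }
  assert (H := RInt_comp_lin (V := R_CompleteNormedModule) (fun s => s ^ 4 * g s) r 0 0 1
                (ex_RInt_cont _ _ _ C)).
  replace (r * 0 + 0) with 0 in H by ring. replace (r * 1 + 0) with r in H by ring.
  rewrite <- H. unfold mean4.
  transitivity (scal (r ^ 5) (RInt (fun t : R => t ^ 4 * g (r * t)) 0 1)); [reflexivity|].
  rewrite <- (RInt_scal (V := R_CompleteNormedModule)).
  - apply RInt_ext. intros x _. unfold scal; simpl; unfold mult; simpl.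
    rewrite Rplus_0_r. ring.
  - apply ex_RInt_cont, continuous_mean4_integrand, Hg.
Qed.

Lemma is_derive_RInt_cont (g : R -> R) (x : R) :
  (forall s, continuous g s) -> is_derive (fun y => RInt g 0 y) x (g x).
Proof.
  intros Hg. apply (is_derive_RInt (V := R_NormedModule) g _ 0 x); [|apply Hg].
  exists (mkposreal 1 Rlt_0_1). intros y _.
  apply (RInt_correct (V := R_CompleteNormedModule)). apply ex_RInt_cont, Hg.
Qed.

Lemma is_derive_pow5_mean4 (g : R -> R) (r : R) :
  (forall s, continuous g s) -> is_derive (fun y => y ^ 5 * mean4 g y) r (r ^ 4 * g r).
Proof.
  intros Hg.
  apply is_derive_ext with (f := fun y => RInt (fun s => s ^ 4 * g s) 0 y).
  - intros t; symmetry; apply mean4_scale, Hg.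
  - apply (is_derive_RInt_cont (fun s => s ^ 4 * g s)).
    intros s. apply (continuous_mult (fun s => s ^ 4) g); [|apply Hg].
    apply continuous_of_ex_derive; auto_derive; auto.
Qed.

(** Away from [0] this is the product rule for [r^(-3)] times [r^5 mean4 g]; at
    [0] that form is meaningless, but [r^2] times a bounded function has
    derivative [0] there. *)
Lemma is_derive_sq_mean4 (g : R -> R) (r e : R) :
  (forall s, continuous g s) -> (forall s, Rabs (mean4 g s) <= e) ->
  is_derive (fun y => y ^ 2 * mean4 g y) r (r * (g r - 3 * mean4 g r)).
Proof.
  intros Hg Hb. destruct (Req_dec r 0) as [->|Hr].
  - rewrite Rmult_0_l. apply is_derive_Reals. intros eps He.
    assert (H0 : 0 <= e) by (eapply Rle_trans; [apply Rabs_pos | apply (Hb 0)]).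
    assert (Hd : 0 < eps / (e + 1)) by (apply Rdiv_lt_0_compat; lra).
    (* The difference quotient at the centre is [k * mean4 g k]. *)
    exists (mkposreal _ Hd). intros k Hk Hkd. simpl in Hkd.
    replace (((0 + k) ^ 2 * mean4 g (0 + k) - 0 ^ 2 * mean4 g 0) / k - 0)
      with (k * mean4 g (0 + k)) by (field; exact Hk).
    rewrite Rabs_mult. specialize (Hb (0 + k)).
    apply Rmult_lt_compat_r with (r := e + 1) in Hkd; [|lra].
    replace (eps / (e + 1) * (e + 1)) with eps in Hkd by (field; lra).
    pose proof (Rabs_pos k). pose proof (Rabs_pos (mean4 g (0 + k))).
    apply Rle_lt_trans with (Rabs k * (e + 1)); [nra | exact Hkd].
  - pose proof (is_derive_pow5_mean4 g r Hg) as HD.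
    apply is_derive_ext_loc with (f := fun y => / y ^ 3 * (y ^ 5 * mean4 g y)).
    + apply (filter_imp (fun y => y <> 0)); [intros y Hy | apply locally_neq_0, Hr].
      change (/ y ^ 3 * (y ^ 5 * mean4 g y) = y ^ 2 * mean4 g y).
      field; auto.
    + replace (r * (g r - 3 * mean4 g r))
        with (plus (mult (- 3 / r ^ 4) (r ^ 5 * mean4 g r)) (mult (/ r ^ 3) (r ^ 4 * g r)))
        by (unfold plus, mult; simpl; field; auto).
      apply (is_derive_mult (fun y => / y ^ 3) (fun y => y ^ 5 * mean4 g y)).
      * auto_derive; [intros H; apply (pow_nonzero r 3 Hr); simpl; lra|].
        field; auto.
      * exact HD.
      * intros; apply Rmult_comm.
Qed.

(** At the centre the integrand is uniformly close to [t^4 g(0)]; elsewhere divide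
    the primitive of [s^4 g(s)] by [r^5]. *)
Lemma continuous_mean4 (g : R -> R) :
  (forall s, continuous g s) -> forall r, continuous (mean4 g) r.
Proof.
  intros Hg r. destruct (Req_dec r 0) as [->|Hr].
  - apply continuous_eps. intros eps He.
    destruct (proj1 (continuous_eps g 0) (Hg 0) eps He) as [d [Hd H]].
    assert (E0 : mean4 g 0 = g 0 / 5).
    { assert (H0 : Rabs (mean4 g 0 - g 0 / 5) <= 0 / 5).
      { apply mean4_near; auto. intros t _. rewrite Rmult_0_l, Rminus_diag, Rabs_R0. lra. }
      apply Rabs_le_between in H0. lra. }
    exists d. split; [exact Hd|]. intros y Hy. rewrite E0.
    apply Rle_lt_trans with (eps / 5); [|lra].
    apply mean4_near; auto. intros t Ht. apply Rlt_le, H.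
    rewrite Rminus_0_r in Hy |- *. rewrite Rabs_mult, (Rabs_pos_eq t) by lra.
    pose proof (Rabs_pos y). nra.
  - apply continuous_ext_loc with (g := fun y => / y ^ 5 * (y ^ 5 * mean4 g y)).
    + apply (filter_imp (fun y => y <> 0)); [intros y Hy | apply locally_neq_0, Hr].
      change (/ y ^ 5 * (y ^ 5 * mean4 g y) = mean4 g y).
      field; auto.
    + apply (continuous_mult (fun y => / y ^ 5) (fun y => y ^ 5 * mean4 g y)).
      * apply (continuous_of_ex_derive (fun y => / y ^ 5)). auto_derive.
        intros H; apply (pow_nonzero r 5 Hr); simpl; lra.
      * apply (continuous_of_ex_derive (fun y => y ^ 5 * mean4 g y)).
        eexists; apply is_derive_pow5_mean4, Hg.
Qed.

(** * Calculus relative to a closed interval *)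

(** Composing with the projection onto [[a, b]] turns continuity relative to the
    interval into continuity on the line, which the classical theorems require. *)
Definition clamp (a b r : R) : R := Rmax a (Rmin b r).

Lemma clamp_in (a b r : R) : a <= b -> a <= clamp a b r <= b.
Proof. intros. unfold clamp, Rmax, Rmin; destruct (Rle_dec b r); destruct (Rle_dec _ _); lra. Qed.

Lemma clamp_id (a b r : R) : a <= r <= b -> clamp a b r = r.
Proof. intros. unfold clamp, Rmax, Rmin; destruct (Rle_dec b r); destruct (Rle_dec _ _); lra. Qed.

Lemma clamp_1lip (a b r s : R) : a <= b -> Rabs (clamp a b r - clamp a b s) <= Rabs (r - s).
Proof.
  intros. unfold clamp, Rmax, Rmin, Rabs.
  destruct (Rle_dec b r); destruct (Rle_dec b s); repeat destruct (Rle_dec _ _);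
  repeat destruct (Rcase_abs _); lra.
Qed.

Lemma continuous_of_lip (f : R -> R) (L x : R) :
  0 <= L -> (forall y, Rabs (f y - f x) <= L * Rabs (y - x)) -> continuous f x.
Proof.
  intros HL H. apply continuous_eps. intros eps He.
  exists (eps / (L + 1)). split; [apply Rdiv_lt_0_compat; lra|].
  intros y Hy. apply Rmult_lt_compat_r with (r := L + 1) in Hy; [|lra].
  replace (eps / (L + 1) * (L + 1)) with eps in Hy by (field; lra).
  eapply Rle_lt_trans; [apply H|]. pose proof (Rabs_pos (y - x)). nra.
Qed.

Lemma continuous_clamp (a b r : R) : a <= b -> continuous (clamp a b) r.
Proof.
  intros Hab. apply continuous_of_lip with 1; [lra|]. intros y.
  rewrite Rmult_1_l. apply clamp_1lip, Hab.
Qed.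

Lemma deriv_on_cont_on (D : R -> Prop) (F dF : R -> R) : deriv_on D F dF -> cont_on D F.
Proof.
  intros H x Hx. exact (cont_deriv F dF D x (H x Hx)).
Qed.

Lemma continuous_clamp_comp (a b : R) (F : R -> R) (x : R) :
  a <= b -> cont_on (fun r => a <= r <= b) F -> continuous (fun r => F (clamp a b r)) x.
Proof.
  intros Hab H. apply continuous_eps. intros eps He.
  destruct (H (clamp a b x) (clamp_in _ _ _ Hab) eps He) as [d [Hd H']].
  exists d. split; [exact Hd|]. intros y Hy.
  destruct (Req_dec (clamp a b y) (clamp a b x)) as [E|E].
  - rewrite E, Rminus_diag, Rabs_R0. exact He.
  - apply (H' (clamp a b y)). split.
    + split; [apply clamp_in, Hab | auto].
    + eapply Rle_lt_trans; [apply clamp_1lip, Hab | exact Hy].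
Qed.

Lemma is_derive_clamp_comp (a b : R) (F dF : R -> R) (x : R) :
  a < x < b -> D_in F dF (fun r => a <= r <= b) x ->
  is_derive (fun r => F (clamp a b r)) x (dF x).
Proof.
  intros Hx H. apply is_derive_Reals. intros eps He.
  destruct (H eps He) as [d [Hd H']].
  assert (Hm : 0 < Rmin d (Rmin (x - a) (b - x))).
  { repeat apply Rmin_glb_lt; lra. }
  exists (mkposreal _ Hm). intros k Hk Hkd. simpl in Hkd.
  pose proof (Rmin_l d (Rmin (x - a) (b - x))).
  pose proof (Rmin_r d (Rmin (x - a) (b - x))).
  pose proof (Rmin_l (x - a) (b - x)). pose proof (Rmin_r (x - a) (b - x)).
  assert (Hk2 : Rabs k < d) by lra.
  apply Rabs_def2 in Hkd.
  rewrite !clamp_id by lra.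
  specialize (H' (x + k)). cbn in H'. unfold Rdist in H'.
  replace (x + k - x) with k in H' by ring.
  apply H'. split; [split; lra | exact Hk2].
Qed.

(** The mean value theorem needs a derivative only in the open interval and
    two-sided continuity on the closed one, and both hold for the function
    composed with the clamp. *)
Lemma mvt_on (a b : R) (F dF : R -> R) (u w : R) :
  deriv_on (fun r => a <= r <= b) F dF -> a <= u <= b -> a <= w <= b ->
  exists c, Rmin u w <= c <= Rmax u w /\ F w - F u = dF c * (w - u).
Proof.
  intros H Hu Hw.
  assert (Hab : a <= b) by lra.
  destruct (MVT_gen (fun r => F (clamp a b r)) u w dF) as [c [Hc E]].
  - intros x Hx. unfold Rmin, Rmax in Hx.
    assert (a < x < b) by (destruct (Rle_dec u w); lra).
    apply is_derive_clamp_comp; [assumption | apply H; lra].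
  - intros x _. apply continuity_pt_filterlim.
    apply (continuous_clamp_comp a b F x Hab). eapply deriv_on_cont_on; exact H.
  - exists c. split; [exact Hc|]. rewrite !clamp_id in E by assumption. exact E.
Qed.

Lemma deriv_on_of_is_derive (D : R -> Prop) (F dF : R -> R) :
  (forall x, D x -> is_derive F x (dF x)) -> deriv_on D F dF.
Proof.
  intros H x Hx eps He.
  destruct (proj1 (is_derive_Reals _ _ _) (H x Hx) eps He) as [d Hd].
  exists d. split; [apply cond_pos|]. intros y [[Hy Hne] Hlt].
  cbn in *. unfold Rdist in *.
  replace (F y) with (F (x + (y - x))) by (f_equal; ring).
  apply Hd; [lra | exact Hlt].
Qed.

Lemma cont_on_of_continuous (D : R -> Prop) (F : R -> R) :
  (forall x, D x -> continuous F x) -> cont_on D F.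
Proof.
  intros H x Hx eps He.
  destruct (proj1 (continuous_eps F x) (H x Hx) eps He) as [d [Hd H']].
  exists d. split; [exact Hd|]. intros y [_ Hlt]. apply H'. exact Hlt.
Qed.

(** * Bounded Lipschitz functions with explicit constants *)

(** The bound is carried along with the Lipschitz constant because products need
    both.  The separation [d] is left free: the rules are used for real numbers
    and for pairs.  Keeping both constants explicit lets them be fixed before
    the energy function is chosen. *)
Definition lip {S : Type} (D : S -> Prop) (d : S -> S -> R) (A L : R) (F : S -> R) : Prop :=
  forall x y, D x -> D y -> Rabs (F x) <= A /\ Rabs (F x - F y) <= L * d x y.

Lemma lip_plus {S} (D : S -> Prop) d A B K L F G :
  lip D d A K F -> lip D d B L G -> lip D d (A + B) (K + L) (fun x => F x + G x).
Proof.
  intros HF HG x y Hx Hy. destruct (HF x y Hx Hy), (HG x y Hx Hy). split.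
  - eapply Rle_trans; [apply Rabs_triang | lra].
  - replace (F x + G x - (F y + G y)) with ((F x - F y) + (G x - G y)) by ring.
    eapply Rle_trans; [apply Rabs_triang | lra].
Qed.

Lemma lip_minus {S} (D : S -> Prop) d A B K L F G :
  lip D d A K F -> lip D d B L G -> lip D d (A + B) (K + L) (fun x => F x - G x).
Proof.
  intros HF HG x y Hx Hy. destruct (HF x y Hx Hy), (HG x y Hx Hy). split.
  - unfold Rminus. eapply Rle_trans; [apply Rabs_triang | rewrite Rabs_Ropp; lra].
  - replace (F x - G x - (F y - G y)) with ((F x - F y) + - (G x - G y)) by ring.
    eapply Rle_trans; [apply Rabs_triang | rewrite Rabs_Ropp; lra].
Qed.

Lemma lip_mult {S} (D : S -> Prop) d A B K L F G :
  lip D d A K F -> lip D d B L G -> lip D d (A * B) (A * L + B * K) (fun x => F x * G x).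
Proof.
  intros HF HG x y Hx Hy. destruct (HF x y Hx Hy), (HG x y Hx Hy).
  destruct (HG y x Hy Hx). split.
  - rewrite Rabs_mult. apply Rmult_le_compat; auto using Rabs_pos.
  - replace (F x * G x - F y * G y) with (F x * (G x - G y) + G y * (F x - F y)) by ring.
    eapply Rle_trans; [apply Rabs_triang|]. rewrite !Rabs_mult.
    replace ((A * L + B * K) * d x y) with (A * (L * d x y) + B * (K * d x y)) by ring.
    apply Rplus_le_compat; apply Rmult_le_compat; auto using Rabs_pos.
Qed.

Lemma lip_bounded_const {S} (D : S -> Prop) d c B :
  Rabs c <= B -> lip D d B 0 (fun _ => c).
Proof.
  intros H x y _ _. split; [lra|]. rewrite Rminus_diag, Rabs_R0; lra.
Qed.

Lemma lip_const {S} (D : S -> Prop) d c : lip D d (Rabs c) 0 (fun _ => c).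
Proof. apply lip_bounded_const; lra. Qed.

Lemma lip_inv {S} (D : S -> Prop) d A K c F :
  0 < c -> (forall x, D x -> c <= F x) ->
  lip D d A K F -> lip D d (/ c) (/ c * / c * K) (fun x => / F x).
Proof.
  intros Hc Hb HF x y Hx Hy. destruct (HF x y Hx Hy).
  assert (I : forall x, D x -> 0 < / F x <= / c).
  { intros z Hz; specialize (Hb z Hz). split.
    - apply Rinv_0_lt_compat; lra.
    - apply Rinv_le_contravar; lra. }
  pose proof (I x Hx). pose proof (I y Hy). split.
  - rewrite Rabs_pos_eq; lra.
  - pose proof (Hb x Hx). pose proof (Hb y Hy).
    replace (/ F x - / F y) with ((/ F x * / F y) * - (F x - F y)) by (field; lra).
    rewrite Rabs_mult, Rabs_Ropp, Rmult_assoc.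
    apply Rmult_le_compat; auto using Rabs_pos.
    rewrite Rabs_pos_eq by nra. nra.
Qed.

Lemma lip_comp {S} (D : S -> Prop) d A K (E : R -> Prop) B L F (V : R -> R) :
  0 <= L -> (forall x, D x -> E (F x)) ->
  lip D d A K F -> lip E (fun u w => Rabs (u - w)) B L V ->
  lip D d B (L * K) (fun x => V (F x)).
Proof.
  intros HL HE HF HV x y Hx Hy. destruct (HF x y Hx Hy).
  destruct (HV (F x) (F y) (HE x Hx) (HE y Hy)). split; [assumption|].
  eapply Rle_trans; [eassumption|]. rewrite Rmult_assoc. apply Rmult_le_compat_l; assumption.
Qed.

Lemma lip_ext {S} (D : S -> Prop) d A L F G :
  (forall x, D x -> F x = G x) -> lip D d A L F -> lip D d A L G.
Proof. intros E H x y Hx Hy. rewrite <- !E by assumption. auto. Qed.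

Lemma continuous_lip_comp (D : R -> Prop) A L (V u : R -> R) s :
  lip D (fun x y => Rabs (x - y)) A L V -> (forall s, D (u s)) ->
  continuous u s -> continuous (fun s => V (u s)) s.
Proof.
  intros HV HD Hu. apply continuous_eps. intros eps He.
  pose proof (Rabs_pos L) as HL.
  destruct (proj1 (continuous_eps u s) Hu (eps / (Rabs L + 1))) as [d [Hd H]].
  { apply Rdiv_lt_0_compat; lra. }
  exists d. split; [exact Hd|]. intros y Hy. specialize (H y Hy).
  destruct (HV (u y) (u s) (HD y) (HD s)) as [_ H1].
  apply Rmult_lt_compat_r with (r := Rabs L + 1) in H; [|lra].
  replace (eps / (Rabs L + 1) * (Rabs L + 1)) with eps in H by (field; lra).
  pose proof (Rle_abs L). pose proof (Rabs_pos (u y - u s)). nra.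
Qed.

(** * Estimates for the energy class *)

Lemma delta_bounds (h M : R) : h <> 0 -> M >= 0 ->
  0 < delta h M /\ delta h M <= 1 / 8 /\ Rabs h * delta h M <= 1 / 8 /\
  M * delta h M <= 1 / 8.
Proof.
  intros Hh HM. assert (Hp : 0 < Rabs h) by (apply Rabs_pos_lt; exact Hh).
  set (d0 := Rmin (1 / 8) (1 / (8 * Rabs h))).
  assert (H0 : 0 < d0) by (apply Rmin_glb_lt; [lra | apply Rdiv_lt_0_compat; lra]).
  assert (H1 : d0 <= 1 / 8) by apply Rmin_l.
  assert (H2 : Rabs h * d0 <= 1 / 8).
  { apply Rle_trans with (Rabs h * (1 / (8 * Rabs h))).
    - apply Rmult_le_compat_l; [lra | apply Rmin_r].
    - right; field; lra. }
  unfold delta. fold d0. cbv zeta. destruct (Req_EM_T M 0) as [->|Hn].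
  - repeat split; lra.
  - assert (HM' : 0 < M) by lra.
    pose proof (Rmin_l d0 (1 / (8 * M))). pose proof (Rmin_r d0 (1 / (8 * M))).
    assert (0 < Rmin d0 (1 / (8 * M))).
    { apply Rmin_glb_lt; [lra | apply Rdiv_lt_0_compat; lra]. }
    repeat split; try lra.
    + nra.
    + apply Rle_trans with (M * (1 / (8 * M))); [nra | right; field; lra].
Qed.

Lemma kappa_pos_neq0 (h : R) : kappa h > 0 -> h <> 0.
Proof. unfold kappa; intros H ->; lra. Qed.

Definition near_delta (h M u : R) : Prop := Rabs (u - 1) <= delta h M.

Lemma deriv_on_near1_itv (F dF : R -> R) :
  deriv_on near1 F dF -> deriv_on (fun r => 7 / 8 <= r <= 9 / 8) F dF.
Proof.
  intros H x Hx eps He. assert (Hn : near1 x) by (apply Rabs_le; lra).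
  destruct (H x Hn eps He) as [d [Hd H']]. exists d. split; [exact Hd|].
  intros y [[Hy Hne] Hlt]. apply H'. repeat split; auto. apply Rabs_le; lra.
Qed.

Lemma mvt_near1 (F dF : R -> R) (u w : R) :
  deriv_on near1 F dF -> near1 u -> near1 w ->
  exists c, Rmin u w <= c <= Rmax u w /\ F w - F u = dF c * (w - u).
Proof.
  intros H Hu Hw. apply Rabs_le_between in Hu. apply Rabs_le_between in Hw.
  apply (mvt_on (7 / 8) (9 / 8)); try lra. apply deriv_on_near1_itv, H.
Qed.

Lemma abs_between (u w c r : R) :
  Rabs (u - 1) <= r -> Rabs (w - 1) <= r -> Rmin u w <= c <= Rmax u w -> Rabs (c - 1) <= r.
Proof.
  intros Hu Hw Hc. apply Rabs_le_between in Hu. apply Rabs_le_between in Hw.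
  unfold Rmin, Rmax in Hc. apply Rabs_le. destruct (Rle_dec u w); lra.
Qed.

Section EnergyClass.
Variables (h M : R) (f f' f'' f''' : R -> R).
Hypotheses (Hh : h <> 0) (HM : M >= 0) (HC : class_C M f f' f'' f''').

Let b := f'' 1.

Lemma class_beta_pos : 0 < b.
Proof. destruct HC as (_ & _ & _ & H & _). exact H. Qed.

Lemma near_delta_near1 u : near_delta h M u -> near1 u.
Proof.
  intros H. destruct (delta_bounds h M Hh HM) as (_ & H1 & _).
  unfold near1, near_delta in *. lra.
Qed.

Lemma class_f2_lip u w : near1 u -> near1 w ->
  Rabs (f'' u - f'' w) <= M * b * Rabs (u - w).
Proof.
  intros Hu Hw. destruct HC as ((_ & _ & H2 & _) & _ & _ & _ & H3).
  destruct (mvt_near1 f'' f''' w u H2 Hw Hu) as [c [Hc E]].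
  rewrite E, Rabs_mult. apply Rmult_le_compat_r; [apply Rabs_pos|].
  apply H3. exact (abs_between _ _ _ _ Hw Hu Hc).
Qed.

(** This is what the part [1/(8M)] of [delta] is for: [f''] varies by at most
    [M beta delta <= beta/8]. *)
Lemma class_f2_bounds u : near_delta h M u -> 7 / 8 * b <= f'' u <= 9 / 8 * b.
Proof.
  intros Hu.
  assert (H1 : near1 1) by (unfold near1; rewrite Rminus_diag, Rabs_R0; lra).
  pose proof (class_f2_lip u 1 (near_delta_near1 _ Hu) H1) as H.
  fold b in H. destruct (delta_bounds h M Hh HM) as (_ & _ & _ & H4).
  pose proof class_beta_pos. unfold near_delta in Hu.
  assert (M * b * Rabs (u - 1) <= b * (1 / 8)).
  { replace (M * b * Rabs (u - 1)) with (b * (M * Rabs (u - 1))) by ring.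
    apply Rmult_le_compat_l; [lra|].
    apply Rle_trans with (2 := H4). apply Rmult_le_compat_l; lra. }
  apply Rabs_le_between in H. lra.
Qed.

Lemma near_delta_1 : near_delta h M 1.
Proof.
  unfold near_delta. rewrite Rminus_diag, Rabs_R0.
  destruct (delta_bounds h M Hh HM); lra.
Qed.

Lemma class_f1_slope u w : near_delta h M u -> near_delta h M w ->
  exists c, Rmin u w <= c <= Rmax u w /\ f' w - f' u = f'' c * (w - u) /\
    7 / 8 * b <= f'' c <= 9 / 8 * b.
Proof.
  intros Hu Hw. destruct HC as ((_ & H1 & _ & _) & _).
  destruct (mvt_near1 f' f'' u w H1 (near_delta_near1 _ Hu) (near_delta_near1 _ Hw)) as [c [Hc E]].
  exists c. split; [exact Hc | split; [exact E|]].
  apply class_f2_bounds. exact (abs_between _ _ _ _ Hu Hw Hc).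
Qed.

Lemma class_f1_near u : near_delta h M u ->
  exists s, f' u = s * (u - 1) /\ 7 / 8 * b <= s <= 9 / 8 * b.
Proof.
  intros Hu. destruct (class_f1_slope 1 u near_delta_1 Hu) as (c & _ & E & B).
  exists (f'' c). split; [|exact B].
  destruct HC as (_ & _ & H0 & _). rewrite H0 in E. lra.
Qed.

Lemma class_f1_bound u : near_delta h M u -> Rabs (f' u) <= 9 / 8 * b * delta h M.
Proof.
  intros Hu. destruct (class_f1_near u Hu) as (s & -> & B).
  rewrite Rabs_mult. pose proof class_beta_pos.
  apply Rmult_le_compat; auto using Rabs_pos. rewrite Rabs_pos_eq; lra.
Qed.

(** Since [f'] is increasing and vanishes at [1], [f'(c)] and [u - 1] have the same
    sign for [c] between [1] and [u]. *)
Lemma class_f_bounds u : near_delta h M u ->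
  1 <= f u <= 1 + 9 / 8 * b * (u - 1) ^ 2.
Proof.
  intros Hu. destruct HC as ((H1 & _) & E0 & _).
  destruct (mvt_near1 f f' 1 u H1 (near_delta_near1 _ near_delta_1) (near_delta_near1 _ Hu))
    as [c [Hc E]].
  assert (Hcd : near_delta h M c) by exact (abs_between _ _ _ _ near_delta_1 Hu Hc).
  destruct (class_f1_near c Hcd) as (s & Es & B). pose proof class_beta_pos.
  rewrite Es, E0 in E. unfold Rmin, Rmax in Hc.
  assert (P : 0 <= (c - 1) * (u - 1) <= (u - 1) ^ 2).
  { destruct (Rle_dec 1 u); nra. }
  replace (s * (c - 1) * (u - 1)) with (s * ((c - 1) * (u - 1))) in E by ring. nra.
Qed.

Lemma class_f_lip u w : near_delta h M u -> near_delta h M w ->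
  Rabs (f u - f w) <= b * Rabs (u - w).
Proof.
  intros Hu Hw. destruct HC as ((H1 & _) & _).
  destruct (mvt_near1 f f' w u H1 (near_delta_near1 _ Hw) (near_delta_near1 _ Hu))
    as [c [Hc E]].
  rewrite E, Rabs_mult. apply Rmult_le_compat_r; [apply Rabs_pos|].
  eapply Rle_trans; [apply class_f1_bound; exact (abs_between _ _ _ _ Hw Hu Hc)|].
  pose proof class_beta_pos. destruct (delta_bounds h M Hh HM) as (_ & H2 & _). nra.
Qed.

Lemma class_f1_lip u w : near_delta h M u -> near_delta h M w ->
  Rabs (f' u - f' w) <= 9 / 8 * b * Rabs (u - w).
Proof.
  intros Hu Hw. destruct (class_f1_slope w u Hw Hu) as (c & _ & -> & B).
  pose proof class_beta_pos.
  rewrite Rabs_mult. apply Rmult_le_compat_r; [apply Rabs_pos|]. rewrite Rabs_pos_eq; lra.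
Qed.

Lemma dquot_bounds u : near_delta h M u -> 7 / 8 * b <= dquot f' f'' u <= 9 / 8 * b.
Proof.
  intros Hu. unfold dquot. pose proof class_beta_pos. destruct (Req_EM_T u 1) as [E|E].
  - fold b; lra.
  - destruct (class_f1_near u Hu) as (s & -> & B).
    replace (s * (u - 1) / (u - 1)) with s by (field; lra). exact B.
Qed.

(** With [f'(u) = f''(e) (u - 1)] and [f'(w) - f'(u) = f''(c) (w - u)] the difference
    of the quotients is [(f''(e) - f''(c)) (w - u)/(w - 1)], and [e], [c] are both
    within [|w - 1|] of [1], the larger of the two distances. *)
Lemma dquot_lip_aux u w : near_delta h M u -> near_delta h M w ->
  Rabs (u - 1) <= Rabs (w - 1) ->
  Rabs (dquot f' f'' u - dquot f' f'' w) <= 2 * M * b * Rabs (u - w).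
Proof.
  intros Hu Hw Huw. pose proof class_beta_pos as Hb.
  (* If [w = 1] then [u = 1] as well. *)
  destruct (Req_dec w 1) as [Ew|Ew].
  { rewrite Ew in *. rewrite Rminus_diag, Rabs_R0 in Huw.
    pose proof (Rabs_pos (u - 1)).
    assert (Eu : u - 1 = 0) by (apply Rabs_eq_0; lra).
    replace u with 1 by lra. rewrite !Rminus_diag, Rabs_R0. lra. }
  assert (Hwp : 0 < Rabs (w - 1)) by (apply Rabs_pos_lt; lra).
  (* [c] lies between [u] and [w], so at distance at most [|w - 1|] from [1]. *)
  destruct (class_f1_slope u w Hu Hw) as (c & Hc & Ec & _).
  assert (Hcw : Rabs (c - 1) <= Rabs (w - 1))
    by (apply (abs_between u w); auto; lra).
  assert (Q : exists e, Rabs (e - 1) <= Rabs (w - 1) /\ f' u = f'' e * (u - 1) /\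
                dquot f' f'' u = f'' e).
  { unfold dquot. destruct (Req_EM_T u 1) as [E|E].
    - exists 1. rewrite Rminus_diag, Rabs_R0, E. repeat split; try lra.
      destruct HC as (_ & _ & H0 & _). rewrite H0; ring.
    - destruct (class_f1_slope 1 u near_delta_1 Hu) as (e & He & Ee & _).
      exists e. destruct HC as (_ & _ & H0 & _). rewrite H0 in Ee.
      split; [|split; [lra|]].
      + apply (abs_between 1 u); auto. rewrite Rminus_diag, Rabs_R0; lra.
      + replace (f' u) with (f'' e * (u - 1)) by lra. field; lra. }
  destruct Q as (e & Hew & Ee & ->).
  assert (Ed : dquot f' f'' w = f' w / (w - 1)).
  { unfold dquot. destruct (Req_EM_T w 1); [contradiction | reflexivity]. }
  rewrite Ed.
  replace (f'' e - f' w / (w - 1)) with ((f'' e - f'' c) * ((w - u) / (w - 1))).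
  2:{ replace (f' w) with (f'' e * (u - 1) + f'' c * (w - u)) by lra. field; lra. }
  assert (Hle : Rabs (f'' e - f'' c) <= M * b * (2 * Rabs (w - 1))).
  { unfold near_delta in Hw.
    eapply Rle_trans.
    - apply class_f2_lip; apply near_delta_near1; unfold near_delta; lra.
    - apply Rmult_le_compat_l; [nra|].
      apply Rabs_le_between in Hew. apply Rabs_le_between in Hcw. apply Rabs_le; lra. }
  rewrite Rabs_mult, Rabs_div by lra. rewrite (Rabs_minus_sym w u).
  apply Rle_trans with (M * b * (2 * Rabs (w - 1)) * (Rabs (u - w) / Rabs (w - 1))).
  - apply Rmult_le_compat_r; [|exact Hle].
    apply Rmult_le_pos; [apply Rabs_pos | apply Rlt_le, Rinv_0_lt_compat, Hwp].
  - right; field; lra.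
Qed.

Lemma dquot_lip u w : near_delta h M u -> near_delta h M w ->
  Rabs (dquot f' f'' u - dquot f' f'' w) <= 2 * M * b * Rabs (u - w).
Proof.
  intros Hu Hw. destruct (Rle_dec (Rabs (u - 1)) (Rabs (w - 1))).
  - apply dquot_lip_aux; auto.
  - rewrite Rabs_minus_sym, (Rabs_minus_sym u w). apply dquot_lip_aux; auto. lra.
Qed.

Hypothesis (Hk : kappa h > 0).

Let N := kappa h + b.

(** The middle term of [U1] carries the factor [h (u - 1)], at most [1/8] by the
    choice of [delta], and is absorbed by [u^2 f'' >= (49/64) (7/8) beta]. *)
Lemma U1_lower u : near_delta h M u -> / 2 <= U1 h f f' f'' u / N.
Proof.
  intros Hu. pose proof class_beta_pos as Hb.
  assert (HN : 0 < N) by (unfold N; lra).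
  apply Rmult_le_reg_r with N; [exact HN|].
  replace (U1 h f f' f'' u / N * N) with (U1 h f f' f'' u) by (field; lra).
  destruct (class_f_bounds u Hu) as [F _].
  destruct (class_f1_near u Hu) as (s & E & B).
  pose proof (class_f2_bounds u Hu) as B2.
  destruct (delta_bounds h M Hh HM) as (_ & D1 & D2 & _).
  assert (X : Rabs (h * (u - 1)) <= 1 / 8).
  { rewrite Rabs_mult. apply Rle_trans with (2 := D2).
    apply Rmult_le_compat_l; [apply Rabs_pos | exact Hu]. }
  assert (Y : Rabs (u - 1) <= 1 / 8) by (unfold near_delta in Hu; lra).
  apply Rabs_le_between in X. apply Rabs_le_between in Y.
  unfold U1, N. rewrite E.
  replace (2 * h / 3 * u * (s * (u - 1))) with (2 / 3 * (u * s) * (h * (u - 1))) by field.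
  assert (Us : 0 <= u * s <= 9 / 8 * (9 / 8 * b)) by (split; [nra|]; apply Rmult_le_compat; nra).
  assert (Uu : 49 / 64 * (7 / 8 * b) <= u ^ 2 * f'' u) by (apply Rmult_le_compat; nra).
  assert (kappa h <= kappa h * f u) by nra.
  nra.
Qed.

Let DN := near_delta h M.
Let du := fun u w : R => Rabs (u - w).

Lemma lip_u : lip DN du 2 1 (fun u => u).
Proof.
  intros u w Hu _. pose proof (near_delta_near1 _ Hu) as H. unfold near1 in H.
  apply Rabs_le_between in H. split; [apply Rabs_le; lra | unfold du; lra].
Qed.

(** Dividing by [N = kappa + beta] removes the factor [beta], which is
    unbounded over the class. *)
Lemma over_N (A x c : R) : 0 <= c -> Rabs x <= c * b * A -> 0 <= A -> Rabs (x / N) <= c * A.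
Proof.
  intros Hc Hx HA. pose proof class_beta_pos as Hb.
  assert (HN : 0 < N) by (unfold N; lra).
  rewrite Rabs_div, (Rabs_pos_eq N) by lra.
  apply Rmult_le_reg_r with N; [exact HN|].
  replace (Rabs x / N * N) with (Rabs x) by (field; lra).
  apply Rle_trans with (1 := Hx). unfold N. assert (0 <= c * A) by nra. nra.
Qed.

Lemma lip_f : lip DN du (1 + kappa h) (kappa h) (fun u => kappa h * f u / N).
Proof.
  intros u w Hu Hw. pose proof class_beta_pos as Hb.
  assert (HN : 0 < N) by (unfold N; lra). split.
  - destruct (class_f_bounds u Hu) as [F1 F2].
    pose proof (near_delta_near1 _ Hu) as Y. unfold near1 in Y. apply Rabs_le_between in Y.
    assert (Z : (u - 1) ^ 2 <= 1 / 64) by nra.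
    assert (F3 : f u <= 1 + b) by nra.
    rewrite Rabs_pos_eq.
    + apply Rmult_le_reg_r with N; [exact HN|].
      replace (kappa h * f u / N * N) with (kappa h * f u) by (field; lra).
      unfold N. nra.
    + apply Rmult_le_pos; [nra | apply Rlt_le, Rinv_0_lt_compat, HN].
  - replace (kappa h * f u / N - kappa h * f w / N)
      with (kappa h * (f u - f w) / N) by (field; lra).
    apply over_N; [lra | | apply Rabs_pos].
    rewrite Rabs_mult, (Rabs_pos_eq (kappa h)), Rmult_assoc by lra.
    apply Rmult_le_compat_l; [lra|]. apply class_f_lip; auto.
Qed.

Lemma lip_over_N A c (F : R -> R) : 0 <= A -> 0 <= c ->
  (forall u, DN u -> Rabs (F u) <= A * b) ->
  (forall u w, DN u -> DN w -> Rabs (F u - F w) <= c * b * Rabs (u - w)) ->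
  lip DN du A c (fun u => F u / N).
Proof.
  intros HA Hc H1 H2 u w Hu Hw. pose proof class_beta_pos as Hb.
  assert (HN : 0 < N) by (unfold N; lra). split.
  - rewrite <- (Rmult_1_r A). apply over_N; [lra | | lra].
    rewrite Rmult_1_r. auto.
  - replace (F u / N - F w / N) with ((F u - F w) / N) by (field; lra).
    apply over_N; [lra | | apply Rabs_pos]. auto.
Qed.

Lemma lip_f1 : lip DN du 1 2 (fun u => f' u / N).
Proof.
  pose proof class_beta_pos as Hb. apply lip_over_N; try lra.
  - intros u Hu. eapply Rle_trans; [apply class_f1_bound, Hu|].
    destruct (delta_bounds h M Hh HM) as (_ & D1 & _). nra.
  - intros u w Hu Hw. eapply Rle_trans; [apply class_f1_lip; auto|].
    apply Rmult_le_compat_r; [apply Rabs_pos | lra].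
Qed.

Lemma lip_f2 : lip DN du 2 M (fun u => f'' u / N).
Proof.
  pose proof class_beta_pos as Hb. apply lip_over_N; try lra.
  - intros u Hu. pose proof (class_f2_bounds u Hu). rewrite Rabs_pos_eq; lra.
  - intros u w Hu Hw. apply class_f2_lip; apply near_delta_near1; auto.
Qed.

Lemma lip_dquot : lip DN du 2 (2 * M) (fun u => dquot f' f'' u / N).
Proof.
  pose proof class_beta_pos as Hb. apply lip_over_N; try lra.
  - intros u Hu. pose proof (dquot_bounds u Hu). rewrite Rabs_pos_eq; lra.
  - intros u w Hu Hw. apply dquot_lip; auto.
Qed.

End EnergyClass.

(** The constants [A], [L] are chosen before [f]; they are read off from the
    composition rules applied to [U1/N] and [U2/N]. *)
Lemma V_lipschitz (h M : R) : kappa h > 0 -> M >= 0 ->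
  exists A L, forall f f' f'' f''', class_C M f f' f'' f''' ->
    lip (near_delta h M) (fun u w => Rabs (u - w)) A L (V1 h f f' f'') /\
    lip (near_delta h M) (fun u w => Rabs (u - w)) A L (V2 h f f' f'').
Proof.
  intros Hk HM. pose proof (kappa_pos_neq0 h Hk) as Hh.
  assert (H1 : exists A1 L1, forall f f' f'' f''', class_C M f f' f'' f''' ->
    lip (near_delta h M) (fun u w => Rabs (u - w)) A1 L1 
     (fun u => / (U1 h f f' f'' u / (kappa h + f'' 1)))).
  { do 2 eexists. intros f f' f'' f''' HC.
    assert (HN : 0 < kappa h + f'' 1).
    { pose proof (class_beta_pos M f f' f'' f''' HC). lra. }
    eapply lip_inv with (c := / 2); [lra | |].
    { intros u Hu. eapply U1_lower; eauto. }
    eapply lip_ext with (F := fun u => kappa h * f u / (kappa h + f'' 1) +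
      2 * h / 3 * (u * (f' u / (kappa h + f'' 1))) + u * (u * (f'' u / (kappa h + f'' 1)))).
    { intros u _. unfold U1. field. lra. }
    eapply lip_plus; [eapply lip_plus; [|eapply lip_mult; [apply lip_const | eapply lip_mult]]
      |eapply lip_mult; [|eapply lip_mult]].
    - eapply lip_f; eauto.
    - eapply lip_u; eauto.
    - eapply lip_f1; eauto.
    - eapply lip_u; eauto.
    - eapply lip_u; eauto.
    - eapply lip_f2; eauto. }
  assert (H2 : exists A1 L1, forall f f' f'' f''', class_C M f f' f'' f''' ->
    lip (near_delta h M) (fun u w => Rabs (u - w)) A1 L1 
     (fun u => U2 h f f' f'' u / (kappa h + f'' 1))).
  { do 2 eexists. intros f f' f'' f''' HC.
    assert (HN : 0 < kappa h + f'' 1).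
    { pose proof (class_beta_pos M f f' f'' f''' HC). lra. }
    eapply lip_ext with (F := fun u => 2 * (u * (kappa h * f u / (kappa h + f'' 1))) +
      (h / 3 - 1) * (u * (u * (f' u / (kappa h + f'' 1)))) 
      + u * u * (2 + u) * (dquot f' f'' u / (kappa h + f'' 1))
      - u * (u * (u * (f'' u / (kappa h + f'' 1))))).
    { intros u _. unfold U2. field. lra. }
    eapply lip_minus; [eapply lip_plus; [eapply lip_plus|]|].
    - eapply lip_mult; [apply lip_const|]. eapply lip_mult; [eapply lip_u | eapply lip_f]; eauto.
    - eapply lip_mult; [apply lip_const|].
      eapply lip_mult; [eapply lip_u; eauto|]. eapply lip_mult; [eapply lip_u | eapply lip_f1]; eauto.
    - eapply lip_mult; [|eapply lip_dquot; eauto].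
      eapply lip_mult; [eapply lip_mult; eapply lip_u; eauto|].
      eapply lip_plus; [apply lip_const | eapply lip_u; eauto].
    - eapply lip_mult; [eapply lip_u; eauto|]. eapply lip_mult; [eapply lip_u; eauto|].
      eapply lip_mult; [eapply lip_u | eapply lip_f2]; eauto. }
  destruct H1 as (A1 & L1 & H1). destruct H2 as (A2 & L2 & H2).
  set (A3 := Rabs 2 + A2 * A1). set (L3 := 0 + (A2 * L1 + A1 * L2)).
  set (A4 := 2 * A1). set (L4 := 2 * L1 + A1 * 1).
  exists (Rmax A3 A4), (Rmax L3 L4). intros f f' f'' f''' HC.
  specialize (H1 _ _ _ _ HC). specialize (H2 _ _ _ _ HC).
  assert (HN : 0 < kappa h + f'' 1).
  { pose proof (class_beta_pos M f f' f'' f''' HC). lra. }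
  assert (HU : forall u, near_delta h M u -> U1 h f f' f'' u <> 0).
  { intros u Hu E. pose proof (U1_lower h M f f' f'' f''' Hh HM HC Hk u Hu) as H.
    rewrite E in H. unfold Rdiv in H. rewrite Rmult_0_l in H. lra. }
  split.
  - assert (H : lip (near_delta h M) (fun u w => Rabs (u - w)) A3 L3 (V1 h f f' f'')).
    { eapply lip_ext; [|eapply lip_minus; [apply (lip_const _ _ 2) | eapply lip_mult; [exact H2 | exact H1]]].
      intros u Hu. specialize (HU u Hu). unfold V1. cbv beta. field. lra. }
    intros u w Hu Hw. destruct (H u w Hu Hw).
    pose proof (Rmax_l A3 A4). pose proof (Rmax_l L3 L4). pose proof (Rabs_pos (u - w)). nra.
  - assert (H : lip (near_delta h M) (fun u w => Rabs (u - w)) A4 L4 (V2 h f f' f'')).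
    { eapply lip_ext; [|eapply lip_mult; [eapply lip_u; eauto | exact H1]].
      intros u Hu. specialize (HU u Hu). unfold V2, beta. cbv beta. field. lra. }
    intros u w Hu Hw. destruct (H u w Hu Hw).
    pose proof (Rmax_r A3 A4). pose proof (Rmax_r L3 L4). pose proof (Rabs_pos (u - w)). nra.
Qed.

(** The coefficient vanishes because [U2(1) = 2 U1(1)]; this makes the homogeneous
    deformation [phi(r) = r] a solution for [mu = 0] and the product
    [V1(u) p] quadratically small near it. *)
Lemma V1_at_1 (h M : R) f f' f'' f''' : kappa h > 0 -> class_C M f f' f'' f''' ->
  V1 h f f' f'' 1 = 0.
Proof.
  intros Hk (_ & E0 & E1 & Hb & _). unfold V1, U1, U2, dquot.
  destruct (Req_EM_T 1 1) as [_|H]; [|exfalso; apply H; reflexivity].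
  rewrite E0, E1. field. lra.
Qed.

Lemma V2_at_1 (h M : R) f f' f'' f''' : kappa h > 0 -> class_C M f f' f'' f''' ->
  V2 h f f' f'' 1 = 1.
Proof.
  intros Hk (_ & E0 & E1 & Hb & _). unfold V2, U1, beta. rewrite E0, E1. field. lra.
Qed.

(** * The reduced right-hand side *)

Definition half_two (v : R) : Prop := 1 / 2 <= v <= 2.

Lemma lip_Rpower (a : R) :
  exists A L, 0 <= L /\ lip half_two (fun v w => Rabs (v - w)) A L (fun v => Rpower v a).
Proof.
  exists (exp (Rabs a * ln 2)), (2 * (Rabs a * exp (Rabs a * ln 2))).
  assert (B : forall v, half_two v -> Rabs (Rpower v a) <= exp (Rabs a * ln 2)).
  { intros v [H1 H2]. unfold Rpower. rewrite Rabs_pos_eq by apply Rlt_le, exp_pos.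
    assert (L1 : ln v <= ln 2) by (apply ln_le; lra).
    assert (L2 : - ln 2 <= ln v).
    { rewrite <- ln_Rinv by lra. apply ln_le; lra. }
    assert (X : a * ln v <= Rabs a * ln 2).
    { apply Rle_trans with (Rabs (a * ln v)); [apply Rle_abs|].
      rewrite Rabs_mult. apply Rmult_le_compat_l; [apply Rabs_pos|]. apply Rabs_le; lra. }
    destruct X as [X|X]; [left; apply exp_increasing, X | rewrite X; right; reflexivity]. }
  split.
  { pose proof (Rabs_pos a). pose proof (exp_pos (Rabs a * ln 2)). nra. }
  intros v w Hv Hw. split; [auto|].
  destruct (MVT_gen (fun z => Rpower z a) w v (fun z => a * / z * Rpower z a)) as [c [Hc E]].
  - intros z Hz. unfold half_two in *. unfold Rmin, Rmax in Hz.
    assert (0 < z) by (destruct (Rle_dec w v); lra).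
    unfold Rpower. auto_derive; [assumption|]. field; lra.
  - intros z Hz. unfold half_two in *. unfold Rmin, Rmax in Hz.
    assert (0 < z) by (destruct (Rle_dec w v); lra).
    apply continuity_pt_filterlim. apply (continuous_of_ex_derive (fun z => Rpower z a)).
    unfold Rpower. auto_derive; assumption.
  - cbv beta in E. rewrite E, Rabs_mult. apply Rmult_le_compat_r; [apply Rabs_pos|].
    assert (Hc' : half_two c).
    { unfold half_two in *. unfold Rmin, Rmax in Hc. destruct (Rle_dec w v); lra. }
    rewrite !Rabs_mult. specialize (B c Hc'). destruct Hc' as [C1 C2].
    assert (Rabs (/ c) <= 2).
    { rewrite Rabs_pos_eq by (apply Rlt_le, Rinv_0_lt_compat; lra).
      replace 2 with (/ (1 / 2)) by field. apply Rinv_le_contravar; lra. }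
    replace (2 * (Rabs a * exp (Rabs a * ln 2))) with (Rabs a * 2 * exp (Rabs a * ln 2)) by ring.
    apply Rmult_le_compat; auto using Rabs_pos.
    + apply Rmult_le_pos; apply Rabs_pos.
    + apply Rmult_le_compat_l; auto using Rabs_pos.
Qed.

(** A state is a pair [(p, L)] with [p = (phi/r)'/r] and [L = phi/r]; the rest
    state is [(0, 1)]. *)
Definition stretch_state (rho : R) (X : R * R) : Prop :=
  Rabs (fst X) <= rho /\ Rabs (snd X - 1) <= rho.

Definition state_dist (X Y : R * R) : R := Rabs (fst X - fst Y) + Rabs (snd X - snd Y).

Definition state_u (x : R) (X : R * R) : R := (snd X + x ^ 2 * fst X) / snd X.
Definition state_v (x : R) (X : R * R) : R := (snd X + x ^ 2 * fst X) * snd X ^ 2.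

Lemma lip_fst rho : rho <= 1 -> lip (stretch_state rho) state_dist 2 1 fst.
Proof.
  intros Hr X Y [H1 H2] _. unfold state_dist.
  pose proof (Rabs_pos (snd X - snd Y)). split; lra.
Qed.

Lemma lip_snd rho : rho <= 1 -> lip (stretch_state rho) state_dist 2 1 snd.
Proof.
  intros Hr X Y [H1 H2] _. unfold state_dist.
  pose proof (Rabs_pos (fst X - fst Y)). split; [|lra].
  apply Rabs_le_between in H2. apply Rabs_le; lra.
Qed.

(** In the form [1 + x^2 p/L] the ratio of stretches does not involve [x] in a
    denominator, so it is controlled up to the centre. *)
Lemma state_u_near (rho x : R) X : rho <= 1 / 32 -> 0 <= x <= 1 -> stretch_state rho X ->
  state_u x X = 1 + x ^ 2 * (fst X / snd X) /\ 0 < snd X /\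
  Rabs (fst X / snd X) <= 2 * Rabs (fst X) /\ Rabs (state_u x X - 1) <= 2 * rho.
Proof.
  intros Hr Hx [H1 H2]. apply Rabs_le_between in H2.
  assert (P : 0 < snd X) by lra.
  assert (E : state_u x X = 1 + x ^ 2 * (fst X / snd X)) by (unfold state_u; field; lra).
  assert (B : Rabs (fst X / snd X) <= 2 * Rabs (fst X)).
  { rewrite Rabs_div, (Rabs_pos_eq (snd X)) by lra.
    apply Rmult_le_reg_r with (snd X); [exact P|].
    replace (Rabs (fst X) / snd X * snd X) with (Rabs (fst X)) by (field; lra).
    pose proof (Rabs_pos (fst X)). nra. }
  repeat split; auto. rewrite E. replace (1 + x ^ 2 * (fst X / snd X) - 1)
    with (x ^ 2 * (fst X / snd X)) by ring.
  rewrite Rabs_mult, (Rabs_pos_eq (x ^ 2)) by nra.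
  assert (x ^ 2 <= 1) by nra. pose proof (Rabs_pos (fst X / snd X)). nra.
Qed.

Lemma state_v_half_two (rho x : R) X : rho <= 1 / 32 -> 0 <= x <= 1 -> stretch_state rho X ->
  half_two (state_v x X).
Proof.
  intros Hr Hx [H1 H2]. apply Rabs_le_between in H1. apply Rabs_le_between in H2.
  unfold half_two, state_v.
  assert (0 <= x ^ 2 <= 1) by nra.
  assert (A : 15 / 16 <= snd X + x ^ 2 * fst X <= 17 / 16) by nra.
  assert (B : 9 / 10 <= snd X ^ 2 <= 11 / 10) by nra.
  nra.
Qed.

Definition forcing (h : R) (f f' f'' : R -> R) (x : R) (X : R * R) : R :=
  Rpower (state_v x X) (- h / 3 + 1) * V2 h f f' f'' (state_u x X).

(** The constant is uniform in [f] and also in the radius [x], which enters only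
    through [x^2 <= 1]. *)
Lemma state_lipschitz (h M : R) : kappa h > 0 -> M >= 0 ->
  exists C, 0 < C /\ forall f f' f'' f''', class_C M f f' f'' f''' ->
    forall x, 0 <= x <= 1 -> forall X Y,
    stretch_state (delta h M / 4) X -> stretch_state (delta h M / 4) Y ->
    Rabs (V1 h f f' f'' (state_u x X) - V1 h f f' f'' (state_u x Y)) <= C * state_dist X Y /\
    Rabs (forcing h f f' f'' x X - forcing h f f' f'' x Y) <= C * state_dist X Y.
Proof.
  intros Hk HM. pose proof (kappa_pos_neq0 h Hk) as Hh.
  destruct (delta_bounds h M Hh HM) as (D0 & D1 & _).
  set (rho := delta h M / 4). assert (Hr : rho <= 1 / 32) by (unfold rho; lra).
  assert (Hr1 : rho <= 1) by lra.
  assert (Hl1 : exists A L, forall x, 0 <= x <= 1 ->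
    lip (stretch_state rho) state_dist A L (fun X => snd X + x ^ 2 * fst X)).
  { do 2 eexists. intros x Hx. eapply lip_plus; [apply lip_snd; lra|].
    eapply lip_mult; [apply (lip_bounded_const _ _ _ 1) | apply lip_fst; lra].
    rewrite Rabs_pos_eq; nra. }
  destruct Hl1 as (Al & Ll & Hl1).
  assert (Hi : forall X, stretch_state rho X -> / 2 <= snd X).
  { intros X [_ H]. apply Rabs_le_between in H. lra. }
  assert (Hu : exists A L, forall x, 0 <= x <= 1 ->
    lip (stretch_state rho) state_dist A L (state_u x)).
  { do 2 eexists. intros x Hx. unfold state_u, Rdiv.
    eapply lip_mult; [apply Hl1, Hx|].
    eapply lip_inv with (c := / 2); [lra | exact Hi | apply lip_snd; lra]. }
  assert (Hv : exists A L, forall x, 0 <= x <= 1 ->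
    lip (stretch_state rho) state_dist A L (state_v x)).
  { do 2 eexists. intros x Hx.
    apply lip_ext with (F := fun X => (snd X + x ^ 2 * fst X) * (snd X * snd X)).
    { intros X _. unfold state_v. ring. }
    eapply lip_mult; [apply Hl1, Hx|]. eapply lip_mult; apply lip_snd; lra. }
  destruct Hu as (Au & Lu & Hu). destruct Hv as (Av & Lv & Hv).
  destruct (lip_Rpower (- h / 3 + 1)) as (Ap & Lp & HLp & Hp).
  destruct (V_lipschitz h M Hk HM) as (AV & LV & HV).
  set (L' := Rabs LV).
  assert (HL' : 0 <= L') by apply Rabs_pos.
  assert (HE : forall x, 0 <= x <= 1 -> forall X, stretch_state rho X ->
    near_delta h M (state_u x X)).
  { intros x Hx X HX. destruct (state_u_near rho x X Hr Hx HX) as (_ & _ & _ & H).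
    unfold near_delta, rho in *. lra. }
  assert (HV1 : forall f f' f'' f''', class_C M f f' f'' f''' ->
    lip (near_delta h M) (fun u w => Rabs (u - w)) AV L' (V1 h f f' f'') /\
    lip (near_delta h M) (fun u w => Rabs (u - w)) AV L' (V2 h f f' f'')).
  { intros f f' f'' f''' HC. destruct (HV _ _ _ _ HC) as [H1 H2].
    pose proof (Rle_abs LV).
    split; intros u w Hu' Hw'; [destruct (H1 u w Hu' Hw') | destruct (H2 u w Hu' Hw')];
    pose proof (Rabs_pos (u - w)); fold L' in H; (split; [assumption | nra]). }
  set (L1 := L' * Lu). set (L2 := Ap * (L' * Lu) + AV * (Lp * Lv)).
  exists (1 + Rabs L1 + Rabs L2).
  pose proof (Rabs_pos L1). pose proof (Rabs_pos L2).
  pose proof (Rle_abs L1). pose proof (Rle_abs L2).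
  split; [lra|]. intros f f' f'' f''' HC x Hx X Y HX HY.
  destruct (HV1 _ _ _ _ HC) as [H3 H4].
  assert (Hd : 0 <= state_dist X Y).
  { unfold state_dist. pose proof (Rabs_pos (fst X - fst Y)).
    pose proof (Rabs_pos (snd X - snd Y)). lra. }
  split.
  - assert (HH : lip (stretch_state rho) state_dist AV L1 (fun X => V1 h f f' f'' (state_u x X))).
    { eapply lip_comp; [exact HL' | apply HE, Hx | apply Hu, Hx | exact H3]. }
    destruct (HH X Y HX HY). nra.
  - assert (HH : lip (stretch_state rho) state_dist (Ap * AV) L2 (forcing h f f' f'' x)).
    { unfold forcing. eapply lip_mult.
      - eapply (lip_comp _ _ _ _ _ _ _ (state_v x) (fun v => Rpower v (- h / 3 + 1)));
          [exact HLp | | apply Hv, Hx | exact Hp].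
        intros Z HZ. eapply state_v_half_two; eauto.
      - eapply lip_comp; [exact HL' | apply HE, Hx | apply Hu, Hx | exact H4]. }
    destruct (HH X Y HX HY). nra.
Qed.

Lemma state_u_rest x : state_u x (0, 1) = 1.
Proof. unfold state_u; simpl; field. Qed.

Lemma forcing_rest (h M : R) f f' f'' f''' x : kappa h > 0 -> class_C M f f' f'' f''' ->
  forcing h f f' f'' x (0, 1) = 1.
Proof.
  intros Hk HC. unfold forcing. rewrite state_u_rest, (V2_at_1 h M f f' f'' f''' Hk HC).
  unfold state_v, Rpower; simpl.
  replace ((1 + x * (x * 1) * 0) * (1 * (1 * 1))) with 1 by ring.
  rewrite ln_1, Rmult_0_r, exp_0. ring.
Qed.

(** The function [G] in [(r^5 p)' = r^4 G]. *)
Definition radial_rhs (h m : R) (f f' f'' : R -> R) (x : R) (X : R * R) : R :=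
  V1 h f f' f'' (state_u x X) * fst X + m * forcing h f f' f'' x X.

Definition small_state (m : R) (X : R * R) : Prop := stretch_state (Rabs m / 4) X.

(** All the smallness the construction needs.  The first bound keeps [G] close to
    [m]; in the second the factor [1] in front of the distance of the states
    suffices for a contraction, because the mean with weight [t^4] gains a
    factor [1/5]. *)
Definition good_radius (h M Rc : R) : Prop :=
  0 < Rc <= delta h M /\
  forall f f' f'' f''', class_C M f f' f'' f''' ->
  (forall m x X, Rabs m <= Rc -> 0 <= x <= 1 -> small_state m X ->
     Rabs (radial_rhs h m f f' f'' x X - m) <= Rabs m / 4) /\
  (forall m n x X Y, Rabs m <= Rc -> Rabs n <= Rc -> 0 <= x <= 1 ->
     small_state m X -> small_state n Y ->
     Rabs (radial_rhs h m f f' f'' x X - radial_rhs h n f f' f'' x Y)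
       <= state_dist X Y + 2 * Rabs (m - n)).

(** On states of size [|m|] the coefficient [V1] is of size [|m|] and the forcing is
    [1 + O(|m|)], by the Lipschitz bounds taken from the rest state.  Hence
    [G - m = O(m^2)], and [G] is Lipschitz in the state with constant [O(|m|)]. *)
Lemma exists_good_radius (h M : R) : kappa h > 0 -> M >= 0 -> exists Rc, good_radius h M Rc.
Proof.
  intros Hk HM. destruct (state_lipschitz h M Hk HM) as (C & HC0 & H).
  pose proof (kappa_pos_neq0 h Hk) as Hh.
  destruct (delta_bounds h M Hh HM) as (D0 & D1 & _).
  (* [C Rc <= 1/4] makes the quadratic errors at most [|m|/4]. *)
  set (Rc := Rmin (delta h M) (/ (4 * C))).
  assert (HR : 0 < Rc) by (apply Rmin_glb_lt; [lra | apply Rinv_0_lt_compat; lra]).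
  assert (HR1 : Rc <= delta h M) by apply Rmin_l.
  assert (HR2 : C * Rc <= 1 / 4).
  { apply Rle_trans with (C * / (4 * C)); [|right; field; lra].
    apply Rmult_le_compat_l; [lra | apply Rmin_r]. }
  exists Rc. split; [lra|]. intros f f' f'' f''' HC.
  specialize (H f f' f'' f''' HC).
  assert (S0 : forall m, Rabs m <= Rc -> stretch_state (delta h M / 4) (0, 1)).
  { intros m _. split; simpl; rewrite ?Rminus_diag, Rabs_R0; lra. }
  assert (Sm : forall m X, Rabs m <= Rc -> small_state m X -> stretch_state (delta h M / 4) X).
  { intros m X Hm [H1 H2]; split; lra. }
  assert (B : forall m x X, Rabs m <= Rc -> 0 <= x <= 1 -> small_state m X ->
    Rabs (V1 h f f' f'' (state_u x X)) <= C * (Rabs m / 2) /\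
    Rabs (forcing h f f' f'' x X - 1) <= C * (Rabs m / 2)).
  { intros m x X Hm Hx HX.
    destruct (H x Hx X (0, 1) (Sm _ _ Hm HX) (S0 _ Hm)) as [H1 H2].
    rewrite state_u_rest, (V1_at_1 h M f f' f'' f''' Hk HC), Rminus_0_r in H1.
    rewrite (forcing_rest h M f f' f'' f''' x Hk HC) in H2.
    assert (state_dist X (0, 1) <= Rabs m / 2).
    { destruct HX as [A1 A2]. unfold state_dist. simpl. rewrite Rminus_0_r. lra. }
    split; nra. }
  split.
  - intros m x X Hm Hx HX. destruct (B m x X Hm Hx HX) as [B1 B2].
    destruct HX as [HX _]. unfold radial_rhs.
    replace (V1 h f f' f'' (state_u x X) * fst X + m * forcing h f f' f'' x X - m)
      with (V1 h f f' f'' (state_u x X) * fst X + m * (forcing h f f' f'' x X - 1)) by ring.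
    eapply Rle_trans; [apply Rabs_triang|]. rewrite !Rabs_mult.
    pose proof (Rabs_pos m).
    assert (Rabs (V1 h f f' f'' (state_u x X)) * Rabs (fst X) <= C * (Rabs m / 2) * (Rabs m / 4))
      by (apply Rmult_le_compat; auto using Rabs_pos).
    assert (Rabs m * Rabs (forcing h f f' f'' x X - 1) <= Rabs m * (C * (Rabs m / 2)))
      by (apply Rmult_le_compat_l; auto using Rabs_pos).
    assert (C * Rabs m <= 1 / 4) by nra. nra.
  - intros m n x X Y Hm Hn Hx HX HY.
    destruct (B m x X Hm Hx HX) as [B1 B2].
    destruct (H x Hx X Y (Sm _ _ Hm HX) (Sm _ _ Hn HY)) as [H1 H2].
    set (d := state_dist X Y) in *.
    assert (Hd : Rabs (fst X - fst Y) <= d).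
    { unfold d, state_dist. pose proof (Rabs_pos (snd X - snd Y)). lra. }
    assert (d0 : 0 <= d) by (pose proof (Rabs_pos (fst X - fst Y)); lra).
    destruct HY as [HY _]. unfold radial_rhs.
    set (vX := V1 h f f' f'' (state_u x X)) in *. set (vY := V1 h f f' f'' (state_u x Y)) in *.
    set (wX := forcing h f f' f'' x X) in *. set (wY := forcing h f f' f'' x Y) in *.
    (* Only [V1], [p] and the parameter, all small, multiply the state distance. *)
    replace (vX * fst X + m * wX - (vY * fst Y + n * wY))
      with (vX * (fst X - fst Y) + (vX - vY) * fst Y + (n * (wX - wY) + (m - n) * wX)) by ring.
    pose proof (Rabs_pos m). pose proof (Rabs_pos n). pose proof (Rabs_pos (m - n)).
    assert (C * Rabs m <= 1 / 4) by nra. assert (C * Rabs n <= 1 / 4) by nra.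
    assert (T1 : Rabs (vX * (fst X - fst Y)) <= C * (Rabs m / 2) * d)
      by (rewrite Rabs_mult; apply Rmult_le_compat; auto using Rabs_pos).
    assert (T2 : Rabs ((vX - vY) * fst Y) <= C * d * (Rabs n / 4))
      by (rewrite Rabs_mult; apply Rmult_le_compat; auto using Rabs_pos).
    assert (T3 : Rabs (n * (wX - wY)) <= Rabs n * (C * d))
      by (rewrite Rabs_mult; apply Rmult_le_compat_l; auto using Rabs_pos).
    assert (W : Rabs wX <= 2).
    { apply Rabs_le_between in B2. apply Rabs_le; lra. }
    assert (T4 : Rabs ((m - n) * wX) <= Rabs (m - n) * 2)
      by (rewrite Rabs_mult; apply Rmult_le_compat_l; auto using Rabs_pos).
    eapply Rle_trans; [apply Rabs_triang|].
    eapply Rle_trans; [apply Rplus_le_compat; apply Rabs_triang|].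
    assert (C * (Rabs m / 2) * d <= d / 8) by nra.
    assert (C * d * (Rabs n / 4) <= d / 16) by nra.
    assert (Rabs n * (C * d) <= d / 4) by nra.
    lra.
Qed.

(** * The profile as a fixed point *)

(** The ratio [phi(r)/r] recovered from the profile [p]. *)
Definition stretch (p : R -> R) (r : R) : R := 1 + RInt (fun s => s * p s) 0 r.

(** The radius is clamped in the coefficients, so that the profile is defined and
    estimated on the whole line; inside [[0, 1]] nothing changes. *)
Definition rhs_along (h m : R) (f f' f'' : R -> R) (p : R -> R) (s : R) : R :=
  radial_rhs h m f f' f'' (clamp 0 1 s) (p s, stretch p (clamp 0 1 s)).

Definition profile_map (h m : R) (f f' f'' : R -> R) (p : R -> R) : R -> R :=
  mean4 (rhs_along h m f f' f'' p).

(** The centre [m/5] is the profile of the equation linearised at the rest state.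
    The margin [|m|/20 = (|m|/4)/5] is the one that the map reproduces, and it
    forces [p] to have the sign of [m]. *)
Definition profile_space (m : R) (p : R -> R) : Prop :=
  (forall s, continuous p s) /\ forall s, Rabs (p s - m / 5) <= Rabs m / 20.

Lemma continuous_id_mult (p : R -> R) s :
  (forall s, continuous p s) -> continuous (fun s => s * p s) s.
Proof.
  intros H. apply (continuous_mult (fun s => s) p); [apply continuous_id | apply H].
Qed.

Lemma is_derive_stretch (p : R -> R) r :
  (forall s, continuous p s) -> is_derive (stretch p) r (r * p r).
Proof.
  intros H. unfold stretch.
  replace (r * p r) with (plus 0 (r * p r)) by (unfold plus; simpl; ring).
  apply (is_derive_plus (fun _ => 1) (fun r => RInt (fun s => s * p s) 0 r)).
  - apply (is_derive_const (V := R_NormedModule)).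
  - apply (is_derive_RInt_cont (fun s => s * p s)). intros; apply continuous_id_mult, H.
Qed.

Lemma stretch_0 p : stretch p 0 = 1.
Proof. unfold stretch. rewrite RInt_point. apply Rplus_0_r. Qed.

Lemma stretch_diff (p q : R -> R) K r :
  (forall s, continuous p s) -> (forall s, continuous q s) ->
  (forall s, Rabs (p s - q s) <= K) -> 0 <= r ->
  Rabs (stretch p r - stretch q r) <= K * r ^ 2.
Proof.
  intros Hp Hq HK Hr. unfold stretch.
  assert (E : RInt (fun s => s * p s) 0 r - RInt (fun s => s * q s) 0 r
     = RInt (fun s => s * p s - s * q s) 0 r).
  { symmetry; apply (RInt_minus (V := R_CompleteNormedModule)); apply ex_RInt_cont;
    intros; apply continuous_id_mult; auto. }
  replace (1 + RInt (fun s => s * p s) 0 r - (1 + RInt (fun s => s * q s) 0 r))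
    with (RInt (fun s => s * p s) 0 r - RInt (fun s => s * q s) 0 r) by ring.
  rewrite E. replace (K * r ^ 2) with ((r - 0) * (r * K)) by ring.
  apply abs_RInt_le_const; [exact Hr | |].
  - apply (ex_RInt_minus (V := R_CompleteNormedModule)); apply ex_RInt_cont;
    intros; apply continuous_id_mult; auto.
  - intros t Ht. replace (t * p t - t * q t) with (t * (p t - q t)) by ring.
    rewrite Rabs_mult, (Rabs_pos_eq t) by lra.
    apply Rmult_le_compat; auto using Rabs_pos; lra.
Qed.

Lemma stretch_near_1 (p : R -> R) K r :
  (forall s, continuous p s) -> (forall s, Rabs (p s) <= K) -> 0 <= r ->
  Rabs (stretch p r - 1) <= K * r ^ 2.
Proof.
  intros Hp HK Hr.
  assert (E : stretch (fun _ => 0) r = 1).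
  { unfold stretch. rewrite (RInt_ext _ (fun _ => 0)).
    - rewrite RInt_const. unfold scal; simpl; unfold mult; simpl; ring.
    - intros; apply Rmult_0_r. }
  rewrite <- E. apply stretch_diff; auto.
  - intros; apply continuous_const.
  - intros s. rewrite Rminus_0_r. auto.
Qed.

Lemma stretch_gt_1 (p : R -> R) r :
  (forall s, continuous p s) -> (forall s, 0 < p s) -> 0 < r -> 1 < stretch p r.
Proof.
  intros Hp H0 Hr. unfold stretch.
  assert (0 < RInt (fun s => s * p s) 0 r); [|lra].
  apply RInt_gt_0; [exact Hr | |].
  - intros x Hx. apply Rmult_lt_0_compat; [lra | apply H0].
  - intros x _. apply continuous_id_mult, Hp.
Qed.

Lemma stretch_lt_1 (p : R -> R) r :
  (forall s, continuous p s) -> (forall s, p s < 0) -> 0 < r -> stretch p r < 1.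
Proof.
  intros Hp H0 Hr.
  assert (G : 1 < stretch (fun s => - p s) r).
  { apply stretch_gt_1; auto.
    - intros s. apply (continuous_opp p), Hp.
    - intros s. specialize (H0 s). lra. }
  unfold stretch in *.
  assert (E : RInt (fun s => s * - p s) 0 r = - RInt (fun s => s * p s) 0 r).
  { rewrite (RInt_ext _ (fun s => opp (s * p s))).
    - apply (RInt_opp (V := R_CompleteNormedModule)). apply ex_RInt_cont.
      intros; apply continuous_id_mult, Hp.
    - intros x _. unfold opp; simpl; ring. }
  lra.
Qed.

Lemma profile_space_bound m p : profile_space m p -> forall s, Rabs (p s) <= Rabs m / 4.
Proof.
  intros [_ H] s. specialize (H s).
  replace (p s) with ((p s - m / 5) + m / 5) by ring.
  eapply Rle_trans; [apply Rabs_triang|].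
  rewrite (Rabs_div m 5), (Rabs_pos_eq 5) by lra. lra.
Qed.

Section Profile.
Variables (h M Rc : R) (f f' f'' f''' : R -> R).
Hypotheses (Hk : kappa h > 0) (HM : M >= 0) (HG : good_radius h M Rc)
  (HC : class_C M f f' f'' f''').

Lemma profile_small_state m p s : profile_space m p ->
  small_state m (p s, stretch p (clamp 0 1 s)).
Proof.
  intros Hp. pose proof (profile_space_bound m p Hp) as B. split; simpl; [apply B|].
  pose proof (clamp_in 0 1 s Rle_0_1) as Hc.
  eapply Rle_trans; [apply (stretch_near_1 p (Rabs m / 4)); auto; [apply Hp | lra]|].
  pose proof (Rabs_pos m). assert (clamp 0 1 s ^ 2 <= 1) by nra. nra.
Qed.

Lemma profile_stretch_state m p s : Rabs m <= Rc -> profile_space m p ->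
  stretch_state (delta h M / 4) (p s, stretch p (clamp 0 1 s)).
Proof.
  intros Hm Hp. destruct (profile_small_state m p s Hp). destruct HG as [[_ H2] _].
  split; lra.
Qed.

(** [V1], [V2] and the power are known only on the domains where they are
    Lipschitz, so continuity of the composites comes from the Lipschitz bounds. *)
Lemma continuous_rhs_along m p : Rabs m <= Rc -> profile_space m p ->
  forall s, continuous (rhs_along h m f f' f'' p) s.
Proof.
  intros Hm Hp s.
  pose proof (kappa_pos_neq0 h Hk) as Hh.
  destruct (delta_bounds h M Hh HM) as (D0 & D1 & _).
  destruct (V_lipschitz h M Hk HM) as (A & L & HV).
  destruct (HV _ _ _ _ HC) as [HV1 HV2]. clear HV.
  pose proof (fun s => profile_stretch_state m p s Hm Hp) as HS.
  assert (Hr : delta h M / 4 <= 1 / 32) by lra.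
  pose proof (fun s => state_u_near (delta h M / 4) (clamp 0 1 s) _ Hr
     (clamp_in 0 1 s Rle_0_1) (HS s)) as HU.
  pose proof (fun s => state_v_half_two (delta h M / 4) (clamp 0 1 s) _ Hr
     (clamp_in 0 1 s Rle_0_1) (HS s)) as HVv.
  assert (Cp : forall s, continuous p s) by apply Hp.
  assert (Cc : forall s, continuous (clamp 0 1) s)
    by (intros; apply continuous_clamp; lra).
  assert (CL : forall s, continuous (fun s => stretch p (clamp 0 1 s)) s).
  { intros z. apply (continuous_comp (clamp 0 1) (stretch p)); [apply Cc|].
    apply continuous_of_ex_derive. eexists. apply is_derive_stretch, Cp. }
  assert (C1 : forall s, continuous (fun s => stretch p (clamp 0 1 s) + clamp 0 1 s ^ 2 * p s) s).
  { intros z. apply (continuous_plus (fun s => stretch p (clamp 0 1 s))); [apply CL|].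
    apply (continuous_mult (fun s => clamp 0 1 s ^ 2) p); [|apply Cp].
    apply (continuous_comp (clamp 0 1) (fun c => c ^ 2)); [apply Cc|].
    apply continuous_of_ex_derive. auto_derive; auto. }
  assert (Cu : forall s, continuous (fun s => state_u (clamp 0 1 s) (p s, stretch p (clamp 0 1 s))) s).
  { intros z. unfold state_u, Rdiv; simpl fst; simpl snd.
    apply (continuous_mult (fun s => stretch p (clamp 0 1 s) + clamp 0 1 s ^ 2 * p s)
             (fun s => / stretch p (clamp 0 1 s))); [apply C1|].
    apply (continuous_comp (fun s => stretch p (clamp 0 1 s)) Rinv); [apply CL|].
    apply continuous_of_ex_derive. auto_derive.
    destruct (HU z) as (_ & H & _). simpl in H. lra. }
  assert (Cv : forall s, continuous (fun s => state_v (clamp 0 1 s) (p s, stretch p (clamp 0 1 s))) s).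
  { intros z. unfold state_v; simpl fst; simpl snd.
    apply (continuous_mult (fun s => stretch p (clamp 0 1 s) + clamp 0 1 s ^ 2 * p s)
             (fun s => stretch p (clamp 0 1 s) ^ 2)); [apply C1|].
    apply (continuous_comp (fun s => stretch p (clamp 0 1 s)) (fun c => c ^ 2)); [apply CL|].
    apply continuous_of_ex_derive. auto_derive; auto. }
  assert (HN : forall s, near_delta h M (state_u (clamp 0 1 s) (p s, stretch p (clamp 0 1 s)))).
  { intros z. destruct (HU z) as (_ & _ & _ & H). unfold near_delta. lra. }
  unfold rhs_along, radial_rhs, forcing. simpl fst.
  apply (continuous_plus (fun s => V1 h f f' f'' (state_u (clamp 0 1 s) (p s, stretch p (clamp 0 1 s))) * p s)
    (fun s => m * (Rpower (state_v (clamp 0 1 s) (p s, stretch p (clamp 0 1 s))) (- h / 3 + 1) *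
       V2 h f f' f'' (state_u (clamp 0 1 s) (p s, stretch p (clamp 0 1 s)))))).
  - apply (continuous_mult (fun s => V1 h f f' f'' (state_u (clamp 0 1 s) (p s, stretch p (clamp 0 1 s)))) p);
      [|apply Cp].
    exact (continuous_lip_comp _ _ _ _ _ s HV1 HN (Cu s)).
  - apply (continuous_scal_r m (fun s => (Rpower (state_v (clamp 0 1 s) (p s, stretch p (clamp 0 1 s))) (- h / 3 + 1) *
       V2 h f f' f'' (state_u (clamp 0 1 s) (p s, stretch p (clamp 0 1 s)))))).
    apply (continuous_mult (fun s => Rpower (state_v (clamp 0 1 s) (p s, stretch p (clamp 0 1 s))) (- h / 3 + 1))
       (fun s => V2 h f f' f'' (state_u (clamp 0 1 s) (p s, stretch p (clamp 0 1 s))))).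
    + destruct (lip_Rpower (- h / 3 + 1)) as (A' & L' & _ & HP).
      exact (continuous_lip_comp _ _ _ _ _ s HP HVv (Cv s)).
    + exact (continuous_lip_comp _ _ _ _ _ s HV2 HN (Cu s)).
Qed.

Lemma rhs_along_near m p s : Rabs m <= Rc -> profile_space m p ->
  Rabs (rhs_along h m f f' f'' p s - m) <= Rabs m / 4.
Proof.
  intros Hm Hp. destruct HG as [_ H]. destruct (H _ _ _ _ HC) as [H1 _].
  apply H1; auto; [apply clamp_in, Rle_0_1 | apply profile_small_state, Hp].
Qed.

Lemma profile_map_stable m p : Rabs m <= Rc -> profile_space m p ->
  profile_space m (profile_map h m f f' f'' p).
Proof.
  intros Hm Hp. pose proof (continuous_rhs_along m p Hm Hp) as Hc. split.
  - apply continuous_mean4, Hc.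
  - intros s. replace (Rabs m / 20) with (Rabs m / 4 / 5) by field.
    apply mean4_near; [exact Hc|]. intros t _. apply rhs_along_near; auto.
Qed.

(** The two components of the state differ by at most [K] each, so the right-hand
    sides differ by at most [2 K + 2 |m - n|], and the mean divides this by [5]. *)
Lemma profile_map_diff m n p q K : Rabs m <= Rc -> Rabs n <= Rc ->
  profile_space m p -> profile_space n q -> 0 <= K -> (forall s, Rabs (p s - q s) <= K) ->
  forall s, Rabs (profile_map h m f f' f'' p s - profile_map h n f f' f'' q s)
    <= K / 2 + Rabs (m - n).
Proof.
  intros Hm Hn Hp Hq HK HD s.
  replace (profile_map h m f f' f'' p s - profile_map h n f f' f'' q s)
    with (profile_map h m f f' f'' p s - profile_map h n f f' f'' q s - 0 / 5) by field.
  apply Rle_trans with ((2 * K + 2 * Rabs (m - n)) / 5).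
  2:{ pose proof (Rabs_pos (m - n)). lra. }
  unfold profile_map. apply mean4_lin.
  - apply continuous_rhs_along; auto.
  - apply continuous_rhs_along; auto.
  - intros t _. rewrite Rminus_0_r. unfold rhs_along.
    destruct HG as [_ H]. destruct (H _ _ _ _ HC) as [_ H2].
    pose proof (clamp_in 0 1 (s * t) Rle_0_1) as Hc.
    eapply Rle_trans; [apply H2; auto; apply profile_small_state; auto|].
    unfold state_dist. simpl.
    pose proof (HD (s * t)).
    assert (Rabs (stretch p (clamp 0 1 (s * t)) - stretch q (clamp 0 1 (s * t))) <= K).
    { eapply Rle_trans; [apply (stretch_diff p q K); auto; [apply Hp | apply Hq | lra]|].
      assert (clamp 0 1 (s * t) ^ 2 <= 1) by nra. nra. }
    lra.
Qed.

Lemma profile_space_closed m : unif_closed (profile_space m).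
Proof.
  intros p H. split.
  - intros s. apply continuous_eps. intros eps He.
    destruct (H (eps / 4)) as (q & [Hq _] & Hqp); [lra|].
    destruct (proj1 (continuous_eps q s) (Hq s) (eps / 4)) as [d [Hd Hd']]; [lra|].
    exists d. split; [exact Hd|]. intros y Hy. specialize (Hd' y Hy).
    pose proof (Hqp y) as Q1. pose proof (Hqp s) as Q2.
    apply Rabs_def2 in Hd'. apply Rabs_le_between in Q1. apply Rabs_le_between in Q2.
    apply Rabs_def1; lra.
  - intros s. apply Rnot_lt_le. intros Hlt.
    destruct (H ((Rabs (p s - m / 5) - Rabs m / 20) / 2)) as (q & [_ Hq] & Hqp); [lra|].
    specialize (Hq s). specialize (Hqp s).
    assert (Rabs (p s - m / 5) <= Rabs (q s - m / 5) + Rabs (q s - p s)).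
    { replace (p s - m / 5) with ((q s - m / 5) + - (q s - p s)) by ring.
      eapply Rle_trans; [apply Rabs_triang | rewrite Rabs_Ropp; lra]. }
    lra.
Qed.

Lemma profile_exists m : Rabs m <= Rc ->
  profile_space m (picard_limit (profile_map h m f f' f'') (fun _ => m / 5)) /\
  forall s, profile_map h m f f' f'' (picard_limit (profile_map h m f f' f'') (fun _ => m / 5)) s
    = picard_limit (profile_map h m f f' f'') (fun _ => m / 5) s.
Proof.
  intros Hm. apply picard_fixed_point with (X := profile_space m) (K := Rabs m).
  - apply Rabs_pos.
  - apply profile_space_closed.
  - intros p q K Hp Hq HK HD s.
    pose proof (profile_map_diff m m p q K Hm Hm Hp Hq HK HD s) as H.
    rewrite Rminus_diag, Rabs_R0 in H. lra.
  - intros p Hp. apply profile_map_stable; auto.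
  - split; [intros; apply continuous_const|]. intros s.
    rewrite Rminus_diag, Rabs_R0. pose proof (Rabs_pos m). lra.
  - intros p q Hp Hq s.
    pose proof (profile_space_bound m p Hp s) as H1.
    pose proof (profile_space_bound m q Hq s) as H2. pose proof (Rabs_pos m).
    apply Rabs_le_between in H1. apply Rabs_le_between in H2. apply Rabs_le; lra.
Qed.

(** The difference of two fixed points satisfies the implication of
    [halving_bound] with [e = |m - n|]. *)
Lemma profile_lipschitz m n p q : Rabs m <= Rc -> Rabs n <= Rc ->
  profile_space m p -> profile_space n q ->
  (forall s, profile_map h m f f' f'' p s = p s) ->
  (forall s, profile_map h n f f' f'' q s = q s) ->
  forall s, Rabs (p s - q s) <= 2 * Rabs (m - n).
Proof.
  intros Hm Hn Hp Hq Fp Fq.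
  apply (halving_bound (fun s => p s - q s) (Rabs m + Rabs n)).
  - pose proof (Rabs_pos m). pose proof (Rabs_pos n). lra.
  - apply Rabs_pos.
  - intros s.
    pose proof (profile_space_bound m p Hp s) as H1.
    pose proof (profile_space_bound n q Hq s) as H2.
    pose proof (Rabs_pos m). pose proof (Rabs_pos n).
    apply Rabs_le_between in H1. apply Rabs_le_between in H2. apply Rabs_le; lra.
  - intros K HK HD s. rewrite <- (Fp s), <- (Fq s). apply profile_map_diff; auto.
Qed.

End Profile.

(** * From the profile to the radial deformation *)

Definition radial (p : R -> R) (r : R) : R := r * stretch p r.
Definition radial_d1 (p : R -> R) (r : R) : R := stretch p r + r ^ 2 * p r.
(** The value of [phi'' = 2 q + r q'] with [q = r p] and [q'] eliminated by
    [r q' = r (g - 4 p)]. *)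
Definition radial_d2 (g p : R -> R) (r : R) : R := r * (g r - 2 * p r).

Lemma lambda2_radial p r : lambda2 (radial p) (radial_d1 p) r = stretch p r.
Proof.
  unfold lambda2, radial, radial_d1. destruct (Req_EM_T r 0) as [->|H].
  - ring.
  - field; exact H.
Qed.

Lemma ufun_radial p r : ufun (radial p) (radial_d1 p) r = state_u r (p r, stretch p r).
Proof. unfold ufun. rewrite lambda2_radial. reflexivity. Qed.

Lemma vfun_radial p r : vfun (radial p) (radial_d1 p) r = state_v r (p r, stretch p r).
Proof. unfold vfun. rewrite lambda2_radial. reflexivity. Qed.

Lemma is_derive_radial p r :
  (forall s, continuous p s) -> is_derive (radial p) r (radial_d1 p r).
Proof.
  intros Hp. unfold radial, radial_d1.
  replace (stretch p r + r ^ 2 * p r)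
    with (plus (mult 1 (stretch p r)) (mult r (r * p r))) by (unfold plus, mult; simpl; ring).
  apply (is_derive_mult (fun r => r) (stretch p)).
  - apply (is_derive_id (K := R_AbsRing)).
  - apply is_derive_stretch, Hp.
  - intros; apply Rmult_comm.
Qed.

Lemma is_derive_radial_d1 g p K r :
  (forall s, continuous p s) -> (forall s, continuous g s) ->
  (forall s, Rabs (p s) <= K) -> (forall s, mean4 g s = p s) ->
  is_derive (radial_d1 p) r (radial_d2 g p r).
Proof.
  intros Hp Hg HK E. unfold radial_d1, radial_d2.
  replace (r * (g r - 2 * p r)) with (plus (r * p r) (r * (g r - 3 * p r)))
    by (unfold plus; simpl; ring).
  apply (is_derive_plus (stretch p) (fun r => r ^ 2 * p r)).
  - apply is_derive_stretch, Hp.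
  - apply is_derive_ext with (f := fun r => r ^ 2 * mean4 g r).
    + intros t. rewrite E. reflexivity.
    + rewrite <- E. apply is_derive_sq_mean4 with (e := K); [exact Hg|].
      intros s. rewrite E. apply HK.
Qed.

Lemma is_quot_radial p r :
  (forall s, continuous p s) -> is_quot (radial p) (radial_d1 p) r (r * p r).
Proof.
  intros Hp. unfold is_quot. destruct (Req_dec r 0) as [->|H].
  - right. split; [reflexivity|].
    apply filterlim_ext_loc with (f := fun s => s * p s).
    + exists (mkposreal 1 Rlt_0_1). intros y _ Hy.
      unfold radial, radial_d1. field. lra.
    + eapply filterlim_filter_le_1; [|exact (continuous_id_mult p 0 Hp)].
      intros Q [e He]. exists e. intros y Hy _. apply He, Hy.
  - left. split; [exact H|]. unfold radial, radial_d1. field. exact H.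
Qed.

Section Solution.
Variables (h M Rc : R) (f f' f'' f''' : R -> R).
Hypotheses (Hk : kappa h > 0) (HM : M >= 0) (HG : good_radius h M Rc)
  (HC : class_C M f f' f'' f''').
Variables (m : R) (p : R -> R).
Hypotheses (Hm : Rabs m <= Rc) (Hp : profile_space m p)
  (Fp : forall s, profile_map h m f f' f'' p s = p s).

Let g := rhs_along h m f f' f'' p.

Lemma radius_le_8 : 0 < Rc <= 1 / 8.
Proof.
  destruct HG as [[H1 H2] _].
  destruct (delta_bounds h M (kappa_pos_neq0 h Hk) HM) as (_ & H3 & _). lra.
Qed.

Lemma rhs_along_on_unit r : unit_itv r ->
  g r = radial_rhs h m f f' f'' r (p r, stretch p r).
Proof.
  intros Hr. unfold g, rhs_along. rewrite clamp_id by exact Hr. reflexivity.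
Qed.

Lemma radial_stretch_near r : unit_itv r -> Rabs (stretch p r - 1) <= Rabs m / 4 * r ^ 2.
Proof.
  intros Hr. apply stretch_near_1; [apply Hp | | apply Hr].
  apply profile_space_bound, Hp.
Qed.

Lemma radial_stretch_pos r : unit_itv r -> 31 / 32 <= stretch p r <= 33 / 32.
Proof.
  intros Hr. pose proof (radial_stretch_near r Hr) as H. pose proof radius_le_8.
  destruct Hr as [H1 H2].
  assert (Rabs m / 4 * r ^ 2 <= 1 / 32).
  { assert (r ^ 2 <= 1) by nra. pose proof (Rabs_pos m). nra. }
  apply Rabs_le_between in H. lra.
Qed.

Lemma ufun_radial_near r : unit_itv r ->
  Rabs (ufun (radial p) (radial_d1 p) r - 1) <= Rabs m * r ^ 2.
Proof.
  intros Hr. rewrite ufun_radial. pose proof (radial_stretch_pos r Hr) as Hs.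
  unfold state_u; simpl fst; simpl snd.
  replace ((stretch p r + r ^ 2 * p r) / stretch p r - 1)
    with ((p r / stretch p r) * r ^ 2) by (field; lra).
  rewrite Rabs_mult, (Rabs_pos_eq (r ^ 2)) by nra.
  apply Rmult_le_compat_r; [nra|].
  rewrite Rabs_div, (Rabs_pos_eq (stretch p r)) by lra.
  apply Rmult_le_reg_r with (stretch p r); [lra|].
  replace (Rabs (p r) / stretch p r * stretch p r) with (Rabs (p r)) by (field; lra).
  pose proof (profile_space_bound m p Hp r). pose proof (Rabs_pos m). nra.
Qed.

Lemma radial_d1_near r : unit_itv r -> Rabs (radial_d1 p r - 1) <= Rabs m * r ^ 2.
Proof.
  intros Hr. unfold radial_d1.
  replace (stretch p r + r ^ 2 * p r - 1) with ((stretch p r - 1) + r ^ 2 * p r) by ring.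
  eapply Rle_trans; [apply Rabs_triang|].
  rewrite Rabs_mult, (Rabs_pos_eq (r ^ 2)) by nra.
  pose proof (radial_stretch_near r Hr). pose proof (profile_space_bound m p Hp r).
  pose proof (Rabs_pos m). assert (0 <= r ^ 2) by nra. nra.
Qed.

(** The triangle inequality [|g| + 2 |p|] would give a constant larger than [1].
    Since [g] is near [m] and [2 p] near [2 m/5], with the same sign, the
    difference is near [3 m/5]. *)
Lemma radial_d2_bound r : unit_itv r -> Rabs (radial_d2 g p r) <= Rabs m * r.
Proof.
  intros Hr. unfold radial_d2. rewrite Rabs_mult, (Rabs_pos_eq r) by apply Hr.
  rewrite Rmult_comm. apply Rmult_le_compat_r; [apply Hr|].
  pose proof (rhs_along_near h M Rc f f' f'' f''' HG HC m p r Hm Hp) as H1.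
  fold g in H1. destruct Hp as [_ H2]. specialize (H2 r).
  apply Rabs_le_between in H1. apply Rabs_le_between in H2.
  destruct (Rle_dec 0 m) as [H|H].
  - rewrite (Rabs_pos_eq m) in * by lra. apply Rabs_le; lra.
  - rewrite (Rabs_left m) in * by lra. apply Rabs_le; lra.
Qed.

Lemma radial_ode r : unit_itv r ->
  exists q, is_quot (radial p) (radial_d1 p) r q /\
    radial_d2 g p r + 2 * q =
    V1 h f f' f'' (ufun (radial p) (radial_d1 p) r) * q
    + m * r * Rpower (vfun (radial p) (radial_d1 p) r) (- h / 3 + 1)
      * V2 h f f' f'' (ufun (radial p) (radial_d1 p) r).
Proof.
  intros Hr. exists (r * p r). split; [apply is_quot_radial, Hp|].
  unfold radial_d2. rewrite rhs_along_on_unit by exact Hr.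
  rewrite ufun_radial, vfun_radial. unfold radial_rhs, forcing. simpl fst. ring.
Qed.

Lemma radial_C2 : C2_on unit_itv (radial p) (radial_d1 p) (radial_d2 g p).
Proof.
  pose proof (continuous_rhs_along h M Rc f f' f'' f''' Hk HM HG HC m p Hm Hp) as Hg.
  split; [|split].
  - apply deriv_on_of_is_derive. intros r _. apply is_derive_radial, Hp.
  - apply deriv_on_of_is_derive. intros r _.
    apply is_derive_radial_d1 with (K := Rabs m / 4).
    + apply Hp.
    + exact Hg.
    + apply profile_space_bound, Hp.
    + exact Fp.
  - apply cont_on_of_continuous. intros r _.
    apply (continuous_mult (fun r => r) (fun r => g r - 2 * p r)); [apply continuous_id|].
    apply (continuous_minus g (fun r => 2 * p r)); [apply Hg|].
    apply (continuous_scal_r 2 p), Hp.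
Qed.

Lemma radial_solution mu : m = mu / (kappa h + beta f'') ->
  solution h M mu f f' f'' (radial p) (radial_d1 p) (radial_d2 g p).
Proof.
  intros Em. split; [exact radial_C2|]. split; [unfold radial; ring|].
  split; [unfold radial_d2; ring|].
  pose proof radius_le_8 as H8. destruct HG as [[_ HR] _].
  assert (R1 : forall r, unit_itv r -> 0 <= r ^ 2 <= 1) by (unfold unit_itv; intros; nra).
  pose proof (Rabs_pos m).
  split; [|split].
  - intros r Hr. pose proof (radial_d1_near r Hr) as H1. specialize (R1 r Hr).
    apply Rabs_le_between in H1. nra.
  - intros r Hr. pose proof (ufun_radial_near r Hr) as H1. specialize (R1 r Hr). nra.
  - intros r Hr. unfold ode_at. rewrite <- Em. apply radial_ode, Hr.
Qed.

Lemma radial_pos : 0 < m -> forall r, 0 < r <= 1 ->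
  stretch p r < radial_d1 p r /\ 1 < stretch p r.
Proof.
  intros H0 r Hr. destruct Hp as [Cp Bp].
  assert (P : forall s, 0 < p s).
  { intros s. specialize (Bp s). rewrite (Rabs_pos_eq m) in Bp by lra.
    apply Rabs_le_between in Bp. lra. }
  split; [|apply stretch_gt_1; auto; apply Hr].
  unfold radial_d1. specialize (P r). assert (0 < r ^ 2) by nra. nra.
Qed.

Lemma radial_neg : m < 0 -> forall r, 0 < r <= 1 ->
  radial_d1 p r < stretch p r /\ stretch p r < 1.
Proof.
  intros H0 r Hr. destruct Hp as [Cp Bp].
  assert (P : forall s, p s < 0).
  { intros s. specialize (Bp s). rewrite (Rabs_left m) in Bp by lra.
    apply Rabs_le_between in Bp. lra. }
  split; [|apply stretch_lt_1; auto; apply Hr].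
  unfold radial_d1. specialize (P r). assert (0 < r ^ 2) by nra. nra.
Qed.

(** Here [u(1) - 1 = p(1)/L(1)], with [p(1)] at least [3 |m|/20] in absolute
    value and [L(1)] close to [1]. *)
Lemma boundary_stretch_sign :
  (0 < m -> m / 20 <= state_u 1 (p 1, stretch p 1) - 1) /\
  (m < 0 -> state_u 1 (p 1, stretch p 1) - 1 <= m / 20).
Proof.
  assert (U : unit_itv 1) by (unfold unit_itv; lra).
  pose proof (radial_stretch_pos 1 U) as Hs.
  assert (E : state_u 1 (p 1, stretch p 1) - 1 = p 1 / stretch p 1).
  { unfold state_u; simpl; field; lra. }
  rewrite E. destruct Hp as [_ B]. specialize (B 1).
  split; intros H.
  - rewrite (Rabs_pos_eq m) in B by lra. apply Rabs_le_between in B.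
    apply Rmult_le_reg_r with (stretch p 1); [lra|].
    replace (p 1 / stretch p 1 * stretch p 1) with (p 1) by (field; lra). nra.
  - rewrite (Rabs_left m) in B by lra. apply Rabs_le_between in B.
    apply Rmult_le_reg_r with (stretch p 1); [lra|].
    replace (p 1 / stretch p 1 * stretch p 1) with (p 1) by (field; lra). nra.
Qed.

End Solution.

(** * The boundary condition *)

(** With [e = |u - 1|], the term [u f'(u)] has size at least [(49/64) beta e], while
    [|h|/3 f(u)] is at most [|h|/3 + (3/8) beta e |h| e] with [|h| e <= 1/8]; the
    bound on [beta] and [e >= Rc/20] give [|h| <= beta e]. *)
Lemma gfun_sign_far (h M Rc : R) f f' f'' f''' u :
  kappa h > 0 -> M >= 0 -> class_C M f f' f'' f''' -> near_delta h M u ->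
  0 < Rc -> 20 * Rabs h / Rc <= beta f'' ->
  (h > 0 -> u - 1 <= - Rc / 20 -> gfun h f f' u < 0) /\
  (h < 0 -> Rc / 20 <= u - 1 -> 0 < gfun h f f' u).
Proof.
  intros Hk HM HC Hu HR HB. pose proof (kappa_pos_neq0 h Hk) as Hh.
  pose proof (class_beta_pos M f f' f'' f''' HC) as Hb.
  destruct (class_f_bounds h M f f' f'' f''' Hh HM HC u Hu) as [F1 F2].
  destruct (class_f1_near h M f f' f'' f''' Hh HM HC u Hu) as (s & E & S).
  destruct (delta_bounds h M Hh HM) as (D0 & D1 & D2 & _).
  assert (X : Rabs h * Rabs (u - 1) <= 1 / 8).
  { apply Rle_trans with (2 := D2). apply Rmult_le_compat_l; [apply Rabs_pos | exact Hu]. }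
  assert (Y : Rabs (u - 1) <= 1 / 8) by (unfold near_delta in Hu; lra).
  unfold beta in *. set (b := f'' 1) in *.
  assert (HB' : Rabs h <= b * (Rc / 20)).
  { apply Rmult_le_compat_r with (r := Rc / 20) in HB; [|lra].
    replace (20 * Rabs h / Rc * (Rc / 20)) with (Rabs h) in HB by (field; lra). exact HB. }
  assert (Us : 49 / 64 * b <= u * s).
  { pose proof Y as Y'. apply Rabs_le_between in Y'.
    replace (49 / 64 * b) with (7 / 8 * (7 / 8 * b)) by field. apply Rmult_le_compat; lra. }
  unfold gfun. rewrite E. split; intros Hs Hur.
  - rewrite (Rabs_pos_eq h) in * by lra. rewrite (Rabs_left (u - 1)) in * by lra.
    set (e := - (u - 1)) in *. replace (u - 1) with (- e) in * by (unfold e; ring).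
    assert (He : Rc / 20 <= e) by lra.
    assert (h <= b * e) by nra.
    assert (h * f u <= h + 9 / 8 * b * e * (h * e)) by nra.
    assert (9 / 8 * b * e * (h * e) <= 9 / 8 * b * e * (1 / 8)) by (apply Rmult_le_compat_l; nra).
    assert (u * s * e >= 49 / 64 * b * e) by nra.
    assert (0 < b * e) by nra. nra.
  - rewrite (Rabs_left h) in * by lra. rewrite (Rabs_pos_eq (u - 1)) in * by lra.
    set (e := u - 1) in *.
    assert (- h <= b * e) by nra.
    assert (- h * f u <= - h + 9 / 8 * b * e * (- h * e)) by nra.
    assert (9 / 8 * b * e * (- h * e) <= 9 / 8 * b * e * (1 / 8)) by (apply Rmult_le_compat_l; nra).
    assert (u * s * e >= 49 / 64 * b * e) by nra.
    assert (0 < b * e) by nra. nra.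
Qed.

Section Family.
Variables (h M Rc : R) (f f' f'' f''' : R -> R).
Hypotheses (Hk : kappa h > 0) (HM : M >= 0) (HG : good_radius h M Rc)
  (HC : class_C M f f' f'' f''').
Variable P : R -> R -> R.
Hypotheses (HP : forall m, Rabs m <= Rc -> profile_space m (P m))
  (FP : forall m, Rabs m <= Rc -> forall s, profile_map h m f f' f'' (P m) s = P m s).

Let b_u (m : R) : R := state_u 1 (P m 1, stretch (P m) 1).

Lemma family_stretch_lip m n r : Rabs m <= Rc -> Rabs n <= Rc -> unit_itv r ->
  Rabs (stretch (P m) r - stretch (P n) r) <= 2 * Rabs (m - n).
Proof.
  intros Hm Hn [Hr1 Hr2].
  apply Rle_trans with (2 * Rabs (m - n) * r ^ 2).
  - apply stretch_diff; auto; try (apply HP; assumption).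
    apply (profile_lipschitz h M Rc f f' f'' f'''); auto.
  - pose proof (Rabs_pos (m - n)). assert (0 <= r ^ 2 <= 1) by nra. nra.
Qed.

Lemma family_radial_lip m n r : Rabs m <= Rc -> Rabs n <= Rc -> unit_itv r ->
  Rabs (radial (P m) r - radial (P n) r) <= 2 * Rabs (m - n).
Proof.
  intros Hm Hn Hr. unfold radial.
  replace (r * stretch (P m) r - r * stretch (P n) r)
    with (r * (stretch (P m) r - stretch (P n) r)) by ring.
  rewrite Rabs_mult, (Rabs_pos_eq r) by apply Hr.
  pose proof (family_stretch_lip m n r Hm Hn Hr).
  pose proof (Rabs_pos (stretch (P m) r - stretch (P n) r)).
  destruct Hr. nra.
Qed.

(** Profiles are controlled for [|m| <= Rc] only; clamping the parameter gives a
    function on the line to which the intermediate value theorem applies. *)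
Lemma continuous_boundary_u t : continuous (fun t => b_u (clamp (- Rc) Rc t)) t.
Proof.
  destruct HG as [[HR _] _].
  assert (U : unit_itv 1) by (unfold unit_itv; lra).
  assert (Hc : forall t, Rabs (clamp (- Rc) Rc t) <= Rc).
  { intros z. apply Rabs_le. apply clamp_in. lra. }
  assert (C1 : forall t, continuous (fun t => P (clamp (- Rc) Rc t) 1) t).
  { intros z. apply continuous_of_lip with 2; [lra|]. intros y.
    eapply Rle_trans; [apply (profile_lipschitz h M Rc f f' f'' f'''
      Hk HM HG HC (clamp (- Rc) Rc y) (clamp (- Rc) Rc z)); auto|].
    apply Rmult_le_compat_l; [lra|]. apply clamp_1lip; lra. }
  assert (C2 : forall t, continuous (fun t => stretch (P (clamp (- Rc) Rc t)) 1) t).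
  { intros z. apply continuous_of_lip with 2; [lra|]. intros y.
    eapply Rle_trans; [apply family_stretch_lip; auto|].
    apply Rmult_le_compat_l; [lra|]. apply clamp_1lip; lra. }
  unfold b_u, state_u, Rdiv. simpl fst; simpl snd.
  apply (continuous_mult (fun t => stretch (P (clamp (- Rc) Rc t)) 1 + 1 ^ 2 * P (clamp (- Rc) Rc t) 1)
     (fun t => / stretch (P (clamp (- Rc) Rc t)) 1)).
  - apply (continuous_plus (fun t => stretch (P (clamp (- Rc) Rc t)) 1)); [apply C2|].
    apply (continuous_scal_r (1 ^ 2) (fun t => P (clamp (- Rc) Rc t) 1)), C1.
  - apply (continuous_comp (fun t => stretch (P (clamp (- Rc) Rc t)) 1) Rinv); [apply C2|].
    apply continuous_of_ex_derive. auto_derive.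
    pose proof (radial_stretch_pos h M Rc Hk HM HG _ _ (Hc t) (HP _ (Hc t)) 1 U). lra.
Qed.

Lemma boundary_u_near m : Rabs m <= Rc -> near_delta h M (b_u m).
Proof.
  intros Hm. assert (U : unit_itv 1) by (unfold unit_itv; lra).
  pose proof (ufun_radial_near h M Rc Hk HM HG m (P m) Hm (HP m Hm) 1 U) as H.
  rewrite ufun_radial in H. destruct HG as [[_ HR] _]. unfold near_delta, b_u. simpl in *. lra.
Qed.

Lemma boundary_u_0 : b_u 0 = 1.
Proof.
  destruct HG as [[HR _] _].
  assert (H0 : Rabs 0 <= Rc) by (rewrite Rabs_R0; lra).
  assert (U : unit_itv 1) by (unfold unit_itv; lra).
  pose proof (ufun_radial_near h M Rc Hk HM HG 0 (P 0) H0 (HP 0 H0) 1 U) as H.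
  rewrite ufun_radial, Rabs_R0, Rmult_0_l in H. apply Rabs_le_between in H. unfold b_u. lra.
Qed.

Lemma continuous_boundary_g t :
  continuous (fun t => gfun h f f' (b_u (clamp (- Rc) Rc t))) t.
Proof.
  destruct HG as [[HR _] _]. pose proof (kappa_pos_neq0 h Hk) as Hh.
  assert (Hc : forall t, Rabs (clamp (- Rc) Rc t) <= Rc).
  { intros z. apply Rabs_le. apply clamp_in. lra. }
  set (u := fun t => b_u (clamp (- Rc) Rc t)).
  assert (Hu : forall t, 7 / 8 <= u t <= 9 / 8).
  { intros z. pose proof (near_delta_near1 h M Hh HM _ (boundary_u_near _ (Hc z))) as H.
    unfold near1 in H. apply Rabs_le_between in H. unfold u. lra. }
  assert (Cu : forall t, continuous u t) by apply continuous_boundary_u.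
  assert (Cf : forall F dF, deriv_on near1 F dF -> forall t, continuous (fun t => F (u t)) t).
  { intros F dF HF z.
    apply continuous_ext with (f := fun t => F (clamp (7 / 8) (9 / 8) (u t))).
    - intros y. rewrite clamp_id by apply Hu. reflexivity.
    - apply (continuous_comp u (fun y => F (clamp (7 / 8) (9 / 8) y))); [apply Cu|].
      apply continuous_clamp_comp; [lra|].
      apply deriv_on_cont_on with dF. apply deriv_on_near1_itv, HF. }
  destruct HC as ((H1 & H2 & _) & _).
  unfold gfun. fold (u t).
  apply (continuous_plus (fun t => h / 3 * f (u t)) (fun t => u t * f' (u t))).
  - apply (continuous_scal_r (h / 3) (fun t => f (u t))). exact (Cf _ _ H1 t).
  - apply (continuous_mult u (fun t => f' (u t))); [apply Cu | exact (Cf _ _ H2 t)].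
Qed.

(** Along the segment from [0] to [- Rc sgn h] the value of [g] at the boundary goes
    from [h/3] to the opposite sign; the zero is not [m = 0] because [h <> 0]. *)
Lemma boundary_eigenvalue : 20 * Rabs h / Rc <= beta f'' ->
  exists m, m <> 0 /\ Rabs m <= Rc /\ sign m = - sign h /\ gfun h f f' (b_u m) = 0.
Proof.
  intros HB. pose proof HG as [[HR _] _]. pose proof (kappa_pos_neq0 h Hk) as Hh.
  set (F := fun t => gfun h f f' (b_u (clamp (- Rc) Rc t))).
  assert (CF : continuity F).
  { intros t. apply continuity_pt_filterlim, continuous_boundary_g. }
  assert (F0 : F 0 = h / 3).
  { unfold F. rewrite clamp_id by lra. rewrite boundary_u_0. unfold gfun.
    destruct HC as (_ & E0 & E1 & _). rewrite E0, E1. ring. }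
  destruct (Rlt_or_le 0 h) as [Hpos|Hneg].
  - assert (Hm : Rabs (- Rc) <= Rc) by (rewrite Rabs_Ropp, Rabs_pos_eq; lra).
    assert (F1 : F (- Rc) < 0).
    { unfold F. rewrite clamp_id by lra.
      apply (gfun_sign_far h M Rc f f' f'' f'''); auto.
      - apply boundary_u_near, Hm.
      - apply (boundary_stretch_sign h M Rc Hk HM HG (- Rc) (P (- Rc)) Hm (HP _ Hm)). lra. }
    destruct (IVT_gen F (- Rc) 0 0 CF) as [t [Ht Et]].
    { rewrite F0, Rmin_left, Rmax_right by lra. lra. }
    rewrite Rmin_left, Rmax_right in Ht by lra.
    assert (t <> 0) by (intros ->; lra).
    exists t. split; [assumption|]. split; [apply Rabs_le; lra|]. split.
    + rewrite sign_eq_m1, sign_eq_1; lra.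
    + unfold F in Et. rewrite clamp_id in Et by lra. exact Et.
  - assert (Hm : Rabs Rc <= Rc) by (rewrite Rabs_pos_eq; lra).
    assert (F1 : 0 < F Rc).
    { unfold F. rewrite clamp_id by lra.
      apply (gfun_sign_far h M Rc f f' f'' f'''); auto.
      - apply boundary_u_near, Hm.
      - lra.
      - apply (boundary_stretch_sign h M Rc Hk HM HG Rc (P Rc) Hm (HP _ Hm)). lra. }
    destruct (IVT_gen F 0 Rc 0 CF) as [t [Ht Et]].
    { rewrite F0, Rmin_left, Rmax_right by lra. lra. }
    rewrite Rmin_left, Rmax_right in Ht by lra.
    assert (t <> 0) by (intros ->; lra).
    exists t. split; [assumption|]. split; [apply Rabs_le; lra|]. split.
    + rewrite sign_eq_1, sign_eq_m1; lra.
    + unfold F in Et. rewrite clamp_id in Et by lra. exact Et.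
Qed.

End Family.

(** * Existence, monotonicity and the eigenvalue *)

Theorem theorem9p1 :
  forall h M : R, kappa h > 0 -> M >= 0 ->
  exists Rc B : R, Rc > 0 /\ B > 0 /\
  forall f f' f'' f''' : R -> R, class_C M f f' f'' f''' ->
  exists phi phi' phi'' : R -> R -> R,
    (forall mu, admissible h Rc f'' mu ->
       solution h M mu f f' f'' (phi mu) (phi' mu) (phi'' mu) /\
       phi' mu 0 = 1 /\
       (forall r, unit_itv r ->
          Rabs (lambda2 (phi mu) (phi' mu) r - 1) <= Rc * r ^ 2 /\
          Rabs (phi' mu r - 1) <= Rc * r ^ 2 /\
          Rabs (ufun (phi mu) (phi' mu) r - 1) <= Rc * r ^ 2 /\
          Rabs (phi'' mu r) <= Rc * r)) /\
    continuous_on (admissible h Rc f'') (fun mu => restr01 (phi mu)) /\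
    (forall mu, admissible h Rc f'' mu ->
       (mu > 0 -> forall r, 0 < r <= 1 ->
          lambda1 (phi' mu) r > lambda2 (phi mu) (phi' mu) r /\
          lambda2 (phi mu) (phi' mu) r > 1) /\
       (mu < 0 -> forall r, 0 < r <= 1 ->
          lambda1 (phi' mu) r < lambda2 (phi mu) (phi' mu) r /\
          lambda2 (phi mu) (phi' mu) r < 1)) /\
    (beta f'' >= B ->
       exists mu, mu <> 0 /\ admissible h Rc f'' mu /\
         sign mu = - sign h /\
         gfun h f f' (ufun (phi mu) (phi' mu) 1) = 0).
Proof.
  intros h M Hk HM. destruct (exists_good_radius h M Hk HM) as [Rc HG].
  pose proof HG as [[HR _] _]. pose proof (kappa_pos_neq0 h Hk) as Hh.
  assert (Hhp : 0 < Rabs h) by (apply Rabs_pos_lt, Hh).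
  exists Rc, (20 * Rabs h / Rc). split; [lra|].
  split; [apply Rdiv_lt_0_compat; lra|].
  intros f f' f'' f''' HC.
  set (N := kappa h + beta f'').
  assert (HN : 0 < N).
  { pose proof (class_beta_pos M f f' f'' f''' HC). unfold N, beta. lra. }
  set (P := fun m => picard_limit (profile_map h m f f' f'') (fun _ => m / 5)).
  assert (HP : forall m, Rabs m <= Rc -> profile_space m (P m)).
  { intros m Hm. apply (profile_exists h M Rc f f' f'' f''' Hk HM HG HC m Hm). }
  assert (FP : forall m, Rabs m <= Rc -> forall s, profile_map h m f f' f'' (P m) s = P m s).
  { intros m Hm. apply (profile_exists h M Rc f f' f'' f''' Hk HM HG HC m Hm). }
  assert (HA : forall mu, admissible h Rc f'' mu <-> Rabs (mu / N) <= Rc).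
  { intros mu. unfold admissible. fold N. rewrite Rabs_div_pos by exact HN. reflexivity. }
  exists (fun mu => radial (P (mu / N))), (fun mu => radial_d1 (P (mu / N))),
    (fun mu => radial_d2 (rhs_along h (mu / N) f f' f'' (P (mu / N))) (P (mu / N))).
  split; [|split; [|split]].
  - intros mu Hmu. apply HA in Hmu. specialize (HP _ Hmu). specialize (FP _ Hmu).
    split; [|split].
    + apply radial_solution with (Rc := Rc) (f''' := f'''); auto.
    + unfold radial_d1. rewrite stretch_0. ring.
    + intros r Hr. rewrite lambda2_radial.
      assert (R2 : 0 <= r ^ 2) by nra. pose proof (Rabs_pos (mu / N)).
      repeat split.
      * eapply Rle_trans; [apply radial_stretch_near with (m := mu / N); auto|]. nra.
      * eapply Rle_trans; [apply radial_d1_near with (m := mu / N); auto|]. nra.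
      * eapply Rle_trans; [apply (ufun_radial_near h M Rc) with (m := mu / N); auto|]. nra.
      * eapply Rle_trans; [apply (radial_d2_bound h M Rc) with (f''' := f'''); auto|].
        apply Rmult_le_compat_r; [apply Hr | exact Hmu].
  - intros mu Hmu. apply filterlim_locally. intros eps.
    assert (He : 0 < eps / 4 * N).
    { apply Rmult_lt_0_compat; [|exact HN]. pose proof (cond_pos eps). lra. }
    exists (mkposreal _ He). intros nu Hnu Anu [r Hr].
    change (Rabs (radial (P (nu / N)) r - radial (P (mu / N)) r) < eps).
    change (Rabs (nu - mu) < eps / 4 * N) in Hnu.
    apply HA in Hmu. apply HA in Anu.
    eapply Rle_lt_trans; [apply (family_radial_lip h M Rc f f' f'' f'''); auto|].
    replace (nu / N - mu / N) with ((nu - mu) / N) by (field; lra).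
    rewrite Rabs_div_pos by exact HN. pose proof (cond_pos eps).
    apply Rmult_lt_reg_r with N; [exact HN|].
    replace (2 * (Rabs (nu - mu) / N) * N) with (2 * Rabs (nu - mu)) by (field; lra). nra.
  - intros mu Hmu. apply HA in Hmu. split; intros Hs r Hr; rewrite lambda2_radial.
    + apply (radial_pos (mu / N) (P (mu / N))); auto. apply Rdiv_lt_0_compat; lra.
    + apply (radial_neg (mu / N) (P (mu / N))); auto.
      apply Rdiv_neg_pos; lra.
  - intros HB. destruct (boundary_eigenvalue h M Rc f f' f'' f''' Hk HM HG HC P HP FP)
      as (m & H0 & H1 & H2 & H3); [apply Rge_le, HB|].
    assert (E : m * N / N = m) by (field; lra).
    exists (m * N). rewrite HA, E. split; [|split; [exact H1 | split]].
    + apply Rmult_integral_contrapositive_currified; lra.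
    + rewrite <- H2. destruct (Rdichotomy _ _ H0) as [Hs|Hs].
      * rewrite !sign_eq_m1; nra.
      * rewrite !sign_eq_1; nra.
    + rewrite ufun_radial. exact H3.
Qed.
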